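(* Let $\mathcal{G}$ be a graph class of polynomial growth with growth rate $\delta$. There exist a constant $c>0$ (depending only on $\mathcal{G}$) and a polynomial-time randomized algorithm that, given a graph $G \in \mathcal{G}$ and an integer $k$, outputs a subset $A \subseteq V(G)$ with the following properties: (1) the treedepth of $G[A]$ is at most $c \cdot k^{1-\frac{1}{1+\delta}} \log k$; (2) for every set $X \subseteq V(G)$ with $|X| \le k$, the probability that $X \subseteq A$ is at least $2^{-c \cdot k^{1-\frac{1}{1+\delta}} \log^2 k}$.
   Context: All graphs are finite, simple and unweighted; $\dist_G(u,v)$ is the number of edges on a shortest $u$–$v$ path in $G$. For $v \in V(G)$ and an integer $r$, $B_G(v,r) = \{w \in V(G) : \dist_G(v,w) < r\}$. A graph class $\mathcal{G}$ has polynomial growth of degree (growth rate) $\delta$ if there is a universal constant $C$ such that for every $G \in \mathcal{G}$, every integer radius $r \ge 1$ and every $v \in V(G)$, $|B_G(v,r)| \le C r^\delta$. Treedepth is defined inductively: the empty graph has treedepth $0$; a connected graph $G$ with at least one vertex has treedepth $1 + \min_{v \in V(G)} \mathrm{treedepth}(G - v)$; a disconnected graph has treedepth equal to the maximum treedepth of its connected components. The probability is over the internal randomness of the algorithm.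
   Formalization: Properties (1) and (2) are stated for k ≥ 2 only: for k ≤ 0 log k is undefined, and for k = 1 log k = 0, so (1) forces A to be empty while (2) forces every single vertex into A. *)

(* Defs.v *)
From HB Require Import structures.
From mathcomp Require Import all_boot all_order all_algebra.
From mathcomp Require Import reals exp.

Set Implicit Arguments.
Unset Strict Implicit.
Unset Printing Implicit Defensive.

Import Order.TTheory GRing.Theory Num.Theory.

Local Open Scope nat_scope.

(* Vertices are numbered 0, ..., nv - 1, as in an algorithm's input. *)
Record sgraph := SGraph {
  nv : nat;
  adj : rel 'I_nv;
  adj_sym : symmetric adj;
  adj_irrefl : irreflexive adj
}.

Definition walk_of_length (G : sgraph) (u v : 'I_(nv G)) (d : nat) : bool :=
  [exists p : d.-tuple 'I_(nv G), path (@adj G) u p && (last u p == v)].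

Lemma connect_walk (G : sgraph) (u v : 'I_(nv G)) :
  connect (@adj G) u v -> exists d, walk_of_length u v d.
Proof.
case/connectP=> p pP ->; exists (size p).
by apply/existsP; exists (in_tuple p); rewrite pP eqxx.
Qed.

(* None is the infinite distance between different components; a shortest walk
   is a shortest path. *)
Definition dist (G : sgraph) (u v : 'I_(nv G)) : option nat :=
  if @idP (connect (@adj G) u v) is ReflectT uv
  then Some (ex_minn (connect_walk uv)) else None.

Definition ball (G : sgraph) (v : 'I_(nv G)) (r : nat) : {set 'I_(nv G)} :=
  [set w | if dist v w is Some d then d < r else false].

Definition polynomial_growth (R : realType) (cG : sgraph -> Prop) (delta : R) :
    Prop :=
  exists C : R, forall G, cG G -> forall r, 1 <= r -> forall v : 'I_(nv G),
    (#|ball v r|%:R <= C * r%:R `^ delta)%R.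

Lemma bigminn_le (I : finType) (P : pred I) (F : I -> nat) (a : nat) (v : I) :
  P v -> \big[minn/a]_(i | P i) F i <= F v.
Proof.
move=> Pv; elim: (index_enum I) (mem_index_enum v) => // i r IH.
rewrite inE big_cons => /orP[/eqP <-|vr]; first by rewrite Pv geq_minl.
by case: ifP => _; rewrite ?(leq_trans (geq_minr _ _)) // IH.
Qed.

Section Treedepth.
Variable G : sgraph.
Implicit Types S : {set 'I_(nv G)}.

Definition adj_in S : rel 'I_(nv G) :=
  [rel x y | [&& x \in S, y \in S & adj x y]].

Definition component S (x : 'I_(nv G)) : {set 'I_(nv G)} :=
  [set y in S | connect (adj_in S) x y].

Definition components S : {set {set 'I_(nv G)}} :=
  [set component S x | x in S].

Definition connected S : bool :=
  [forall x in S, forall y in S, connect (adj_in S) x y].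

(* m bounds the recursion depth.  The default #|S| of the minimum is harmless,
   because the set S is nonempty and the treedepth of G[S - v] is below #|S|. *)
Fixpoint treedepth_rec (m : nat) S : nat :=
  if m is m'.+1 then
    if S == set0 then 0
    else if connected S then
      (\big[minn/#|S|]_(v in S) treedepth_rec m' (S :\ v)).+1
    else \max_(C in components S) treedepth_rec m' C
  else 0.

(* The treedepth of the induced subgraph G[S]; see the equations
   treedepth0, treedepth_conn and treedepth_disconn below. *)
Definition treedepth S : nat := treedepth_rec #|S| S.

Lemma component_proper S x :
  ~~ connected S -> x \in S -> #|component S x| < #|S|.
Proof.
move=> nS xS; apply: proper_card; rewrite properEneq.
have sub : component S x \subset S by apply/subsetP=> y; rewrite inE => /andP[].
rewrite sub andbT; apply: contra nS => /eqP eS.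
have sym : connect_sym (adj_in S).
  apply: sym_connect_sym => a b; rewrite /adj_in /=.
  by rewrite (adj_sym a b) andbCA.
apply/forall_inP=> a aS; apply/forall_inP=> b bS.
move: aS bS; rewrite -{1 2}eS !inE => /andP[_ xa] /andP[_ xb].
by rewrite (connect_trans _ xb) // sym.
Qed.

Lemma treedepth_rec_le m S : #|S| <= m -> treedepth_rec m S = treedepth S.
Proof.
rewrite /treedepth; have [n] := ubnP #|S|; elim: n m S => // n IH m S.
rewrite ltnS => Sn; have [->|S0] := eqVneq S set0.
  by rewrite cards0; case: m => //= m _; rewrite eqxx.
case: m => [|m] Sm; first by rewrite leqn0 cards_eq0 (negPf S0) in Sm.
have /prednK eS : 0 < #|S| by rewrite card_gt0.
rewrite -eS /= (negPf S0); case: ifPn => cS.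
  congr _.+1; apply: eq_bigr => v vS.
  have e : #|S :\ v| = #|S|.-1 by rewrite [in RHS](cardsD1 v) vS.
  by rewrite !IH // e -ltnS eS.
apply: eq_bigr => C /imsetP[x xS ->].
have lt := component_proper cS xS.
by rewrite !IH // ?(leq_trans lt) // -ltnS ?eS // (leq_trans lt).
Qed.

Lemma treedepth_le S : treedepth S <= #|S|.
Proof.
have [n] := ubnP #|S|; elim: n S => // n IH S; rewrite ltnS => Sn.
have [->|S0] := eqVneq S set0; first by rewrite /treedepth cards0.
have /prednK eS : 0 < #|S| by rewrite card_gt0.
rewrite /treedepth -{1}eS /= (negPf S0); case: ifPn => cS.
  have /set0Pn[v vS] := S0.
  have e : #|S| = #|S :\ v|.+1 by rewrite (cardsD1 v) vS.
  have le : #|S :\ v| <= #|S|.-1 by rewrite e.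
  rewrite -eS ltnS (leq_trans (bigminn_le _ _ vS)) // treedepth_rec_le //.
  by rewrite (leq_trans (IH _ _)) // -e.
apply/bigmax_leqP => C /imsetP[x xS ->].
have lt := component_proper cS xS.
rewrite treedepth_rec_le; last by rewrite -ltnS eS.
by rewrite (leq_trans (IH _ (leq_trans lt Sn))) // ltnW.
Qed.

Lemma treedepth0 : treedepth set0 = 0.
Proof. by rewrite /treedepth cards0. Qed.

Lemma treedepth_conn S : S != set0 -> connected S ->
  (exists2 v, v \in S & treedepth S = (treedepth (S :\ v)).+1) /\
  (forall v, v \in S -> treedepth S <= (treedepth (S :\ v)).+1).
Proof.
move=> S0 cS; have /prednK eS : 0 < #|S| by rewrite card_gt0.
have cD v : v \in S -> #|S :\ v|.+1 = #|S| by move=> vS; rewrite [RHS](cardsD1 v) vS.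
have eq : treedepth S = (\big[minn/#|S|]_(v in S) treedepth (S :\ v)).+1.
  rewrite {1}/treedepth -{1}eS /= (negPf S0) cS; congr _.+1.
  by apply: eq_bigr => v vS; rewrite treedepth_rec_le // -ltnS eS cD.
have le v : v \in S -> treedepth S <= (treedepth (S :\ v)).+1.
  by move=> vS; rewrite eq ltnS bigminn_le.
split=> //.
have /set0Pn[v0 v0S] := S0.
have [v vS vmin] := arg_minnP (fun v => treedepth (S :\ v)) v0S.
exists v => //; apply/eqP; rewrite eqn_leq le //= eq ltnS.
elim/big_ind: _ => [|a b|w wS]; last exact: vmin.
  by rewrite (leq_trans (treedepth_le _)) // ltnW // cD.
by rewrite leq_min => -> ->.
Qed.

Lemma treedepth_disconn S : ~~ connected S ->
  treedepth S = \max_(C in components S) treedepth C.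
Proof.
move=> cS; have S0 : S != set0.
  by apply: contra cS => /eqP->; apply/forall_inP=> x; rewrite inE.
have /prednK eS : 0 < #|S| by rewrite card_gt0.
rewrite {1}/treedepth -{1}eS /= (negPf S0) (negPf cS).
apply: eq_bigr => C /imsetP[x xS ->].
by rewrite treedepth_rec_le // -ltnS eS component_proper.
Qed.

End Treedepth.

(* Algorithms are programs of a structured random access machine.  The memory
   consists of two-dimensional arrays of natural numbers (a scalar variable x
   is the cell x[0,0]), the arithmetic is addition and truncated subtraction,
   and the only randomness is a fair coin.  A step takes unit time; since there
   is no multiplication, t steps lengthen the numbers by O(t) bits only, so
   this time is polynomially related to that of a probabilistic Turing
   machine. *)
Inductive expr :=
| Num of nat
| Get of nat & expr & expr
| Add of expr & expr
| Sub of expr & expr.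

Inductive cmd :=
| Skip
| Put of nat & expr & expr & expr  (* Put x i j e  is  x[i,j] := e *)
| Flip of nat                      (* Flip x  is  x[0,0] := fair coin *)
| Seq of cmd & cmd
| If of expr & cmd & cmd
| While of expr & cmd.

Definition memory := nat -> nat -> nat -> nat.

Definition upd (m : memory) (x i j a : nat) : memory := fun x' i' j' =>
  if [&& x' == x, i' == i & j' == j] then a else m x' i' j'.

Fixpoint eval (m : memory) (e : expr) : nat :=
  match e with
  | Num a => a
  | Get x e1 e2 => m x (eval m e1) (eval m e2)
  | Add e1 e2 => eval m e1 + eval m e2
  | Sub e1 e2 => eval m e1 - eval m e2
  end.

(* The commands that remain to be executed, and the memory. *)
Definition config : Type := seq cmd * memory.

Definition halted (s : config) : bool := nilp s.1.

(* Every step is supplied with a fresh coin b, which only Flip looks at. *)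
Definition step (s : config) (b : bool) : config :=
  let: (K, m) := s in
  match K with
  | [::] => s
  | Skip :: K' => (K', m)
  | Put x i j e :: K' => (K', upd m x (eval m i) (eval m j) (eval m e))
  | Flip x :: K' => (K', upd m x 0 0 b)
  | Seq c1 c2 :: K' => ([:: c1, c2 & K'], m)
  | If e c1 c2 :: K' => ((if eval m e != 0 then c1 else c2) :: K', m)
  | While e c :: K' => (if eval m e != 0 then [:: c, While e c & K'] else K', m)
  end.

(* Input: n in 0[0,0], k in 1[0,0], the adjacency matrix in array 2. *)
Definition input (G : sgraph) (k : nat) : memory := fun x i j =>
  match x with
  | 0 => if (i == 0) && (j == 0) then nv G else 0
  | 1 => if (i == 0) && (j == 0) then k else 0
  | 2 => if (insub i, insub j) is (Some u, Some v) then adj (s := G) u v : nat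
         else 0
  | _ => 0
  end.

(* up_log 2 k.+1 is the number of binary digits of k. *)
Definition input_size (G : sgraph) (k : nat) : nat := nv G + up_log 2 k.+1.

Definition run (alg : cmd) (G : sgraph) (k : nat) (w : seq bool) : config :=
  foldl step ([:: alg], input G k) w.

(* Output: the vertices v with a nonzero entry 3[v,0]. *)
Definition output (alg : cmd) (G : sgraph) (k : nat) (w : seq bool) :
    {set 'I_(nv G)} :=
  [set v : 'I_(nv G) | (run alg G k w).2 3 v 0 != 0].

(* The probability that the output after T steps satisfies P. *)
Definition Pr_output (R : realType) (alg : cmd) (G : sgraph) (k T : nat)
    (P : pred {set 'I_(nv G)}) : R :=
  (#|[set w : T.-tuple bool | P (output alg G k w)]|%:R / 2 ^+ T)%R.

Definition log2 (R : realType) (x : R) : R := (ln x / ln 2)%R.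

(* Main.v *)
(** Put alpha = 1 / (1 + delta), let r be a power of 2, L of order log k, and
    rho = r * L.  Every vertex u draws a radius that is geometric with parameter
    1 / r, truncated at rho + 1.  A vertex x belongs to the first u that catches
    it, i.e. whose radius is at least dist(u, x), and it is interior if the
    radius is larger than that.  Adjacent interior vertices have the same
    center.  A vertex x is not interior with probability at most 2 / r: given
    that u catches x and that dist(u, x) <= rho, the radius of u equals
    dist(u, x) with probability 1 / r because geometric variables are
    memoryless; a radius is truncated with probability at most 2^-L, and only
    polynomially many centers are at distance rho + 1 from x.  By Markov's
    inequality, with probability 1/2 at most 4k / r vertices of X are not
    interior.  Moreover every vertex is kept with probability 2^-L.  Near X,
    exactly the vertices of X that are not interior are kept with probability
    at least 2^(- 4Lk / r - 1).

    The output consists of the interior and the kept vertices that see at most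
    4k / r kept vertices within a large polynomial distance.  A connected
    subset of it has at most 4k / r kept vertices: clusters have diameter at
    most 2 * rho, so every annulus of width 2 * rho + 2 which it crosses contains a
    kept one.  Without kept vertices it lies in one cluster.  So the treedepth
    is at most 4k / r plus the size of the largest cluster.

    The exponent alpha may be uncomputable.  The program therefore reads r off
    the graph: it doubles r as long as rho * |B| = O(k) for all balls B of
    radius rho.  Polynomial growth makes this stop only when rho is of order at
    least k^alpha, hence k / r = O(k^(1 - alpha) log k), and clusters have size
    O(k / rho).  All coins are flipped in one loop between two deterministic
    computations, so that the output is a function of a uniform vector of
    coins. *)

Require Import Defs.
From HB Require Import structures.
From mathcomp Require Import all_boot all_order all_algebra.
From mathcomp Require Import reals exp.
From mathcomp Require Import zify ring lra.

Set Implicit Arguments.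
Unset Strict Implicit.
Unset Printing Implicit Defensive.

Import Order.TTheory GRing.Theory Num.Theory.

Local Open Scope nat_scope.


(** * Programs without coin flips *)

Notation lit := Defs.Num (only parsing).

Definition var x := Get x (lit 0) (lit 0).
Definition assign x e := Put x (lit 0) (lit 0) e.
Definition For i e c :=
  Seq (assign i (lit 0))
    (While (Defs.Sub e (var i)) (Seq c (assign i (Add (var i) (lit 1))))).
(** Multiplication by a constant is iterated addition; the lock keeps simplification from unfolding
    the [a] summands. *)
Definition scale a e := locked (iter a (Add e) (lit 0)).

Lemma eval_scale m a e : eval m (scale a e) = a * eval m e.
Proof. by rewrite /scale -lock; elim: a => //= a ->; rewrite mulSn. Qed.

Arguments upd _ _ _ _ _ _ _ _ /.

(** A syntactic superset of the arrays that a command can change; it supplies the frame conditions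
    of all later invariants. *)
Fixpoint writes c : seq nat :=
  match c with
  | Skip => [::]
  | Put x _ _ _ => [:: x]
  | Flip x => [:: x]
  | Seq c1 c2 => writes c1 ++ writes c2
  | If _ c1 c2 => writes c1 ++ writes c2
  | While _ c => writes c
  end.

Lemma step_writes K m b (V : seq nat) : {subset flatten (map writes K) <= V} ->
  {subset flatten (map writes (step (K, m) b).1) <= V} /\
  forall x, x \notin V -> forall i j, (step (K, m) b).2 x i j = m x i j.
Proof.
have updF y i j a x : x \in V -> y \notin V -> forall i' j',
    upd m x i j a y i' j' = m y i' j'.
  move=> xV yV i' j'; rewrite /upd; case: eqP => // e.
  by rewrite -e (negPf yV) in xV.
case: K => [|[|x i j e|x|c1 c2|e c1 c2|e c] K] //= sub; split=> //.
- by move=> y yK; apply: sub; rewrite inE yK orbT.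
- by move=> y yV; apply: updF => //; apply: sub; rewrite inE eqxx.
- by move=> y yK; apply: sub; rewrite inE yK orbT.
- by move=> y yV; apply: updF => //; apply: sub; rewrite inE eqxx.
- by move=> y yK; apply: sub; rewrite -catA.
- move=> y; rewrite mem_cat => /orP[] yK; apply: sub; rewrite !mem_cat ?yK ?orbT //.
  by case: ifP yK => _ -> //; rewrite orbT.
- case: ifP => _ y yK; apply: sub; move: yK; rewrite /= !mem_cat; last by move->; rewrite orbT.
  by case/or3P => ->; rewrite ?orbT.
Qed.

Lemma run_writes w K m (V : seq nat) : {subset flatten (map writes K) <= V} ->
  forall x, x \notin V -> forall i j, (foldl step (K, m) w).2 x i j = m x i j.
Proof.
elim: w K m => // b w IH K m sub x xV i j.
have [sub' eq] := step_writes m b sub.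
change ((foldl step (step (K, m) b) w).2 x i j = m x i j).
by case: (step (K, m) b) sub' eq => K' m' sub' eq; rewrite IH //; apply: eq.
Qed.

(** Bounds the running time if every loop makes at most [B] iterations. A loop pays for each test,
    including the last; a conditional is charged for both branches. *)
Fixpoint cost B c :=
  match c with
  | Skip | Put _ _ _ _ | Flip _ => 1
  | Seq c1 c2 | If _ c1 c2 => (cost B c1 + cost B c2).+1
  | While _ c => (B * (cost B c).+1).+1
  end.

Section WeakestPrecondition.
(* B bounds the number of iterations of every loop. *)
Variable B : nat.
Implicit Types (c : cmd) (m : memory) (Q : memory -> Prop).

(* The command c, started in memory m, stops in a memory that satisfies Q and
   that depends on no coin. *)
Definition wp c Q m :=
  exists t m', [/\ t <= cost B c, Q m' &
    forall K w, size w = t -> foldl step (c :: K, m) w = (K, m')].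

(** The rule of consequence with framing built in: the final memory comes from an actual run, so
    arrays that [c] does not write are unchanged. *)
Lemma wp_sub c Q Q' m :
  wp c Q m ->
  (forall m', (forall x, x \notin writes c -> forall i j, m' x i j = m x i j) ->
     Q m' -> Q' m') ->
  wp c Q' m.
Proof.
move=> [s [m' [st q run]]] imp; exists s, m'; split=> //.
apply: imp => // x xc i j.
(* The run depends on no coin, so the all-[false] sequence stands for every other one. *)
have := @run_writes (nseq s false) [:: c] m (writes c).
by rewrite run ?size_nseq //= cats0 => ->.
Qed.

Lemma wp_skip Q m : Q m -> wp Skip Q m.
Proof. by move=> q; exists 1, m; split=> // K [|b []]. Qed.

Lemma wp_put x i j e Q m :
  Q (upd m x (eval m i) (eval m j) (eval m e)) -> wp (Put x i j e) Q m.
Proof. by move=> q; eexists 1, _; split; [|exact: q|case=> [|? ?] [|? []]]. Qed.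

Lemma foldl_split (s : config) w t1 t2 : size w = t1 + t2 ->
  exists w1 w2, [/\ size w1 = t1, size w2 = t2 &
    foldl step s w = foldl step (foldl step s w1) w2].
Proof.
move=> sw; exists (take t1 w), (drop t1 w).
rewrite size_takel ?size_drop ?sw ?leq_addr // addKn; split=> //.
by rewrite -foldl_cat cat_take_drop.
Qed.

Lemma wp_seq c1 c2 Q m : wp c1 (wp c2 Q) m -> wp (Seq c1 c2) Q m.
Proof.
move=> [s1 [m1 [st1 [s2 [m2 [st2 q run2]]] run1]]].
exists (s1 + s2).+1, m2; split=> // [|K [|b w]] //=.
  by rewrite ltnS leq_add.
case=> sw; have [w1 [w2 [sw1 sw2 ->]]] := foldl_split ([:: c1, c2 & K], m) sw.
by rewrite run1 // run2.
Qed.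

Lemma wp_if e c1 c2 Q m :
  (eval m e != 0 -> wp c1 Q m) -> (eval m e = 0 -> wp c2 Q m) ->
  wp (If e c1 c2) Q m.
Proof.
move=> h1 h2; suff [s [m' [st q run]]] : wp (if eval m e != 0 then c1 else c2) Q m.
  exists s.+1, m'; split=> // [|K [|b w] //= [sw]]; last by rewrite run.
  by rewrite ltnS (leq_trans st) //; case: ifP; rewrite ?leq_addr ?leq_addl.
by case: ifPn => [/h1|/negPn/eqP/h2].
Qed.

Lemma wp_ifb e c1 c2 (b : bool) Q m : (eval m e != 0) = b ->
  (b -> wp c1 Q m) -> (~~ b -> wp c2 Q m) -> wp (If e c1 c2) Q m.
Proof.
move=> eb h1 h2; apply: wp_if; first by rewrite eb.
by move/eqP; rewrite -[_ == 0]negbK eb.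
Qed.

(** Indexing the invariant by the number of completed iterations yields termination after exactly
    [N] of them together with the time bound. *)
Lemma wp_while e c N (I : nat -> memory -> Prop) m :
  N <= B -> I 0 m ->
  (forall j m', (forall x, x \notin writes c -> forall i j, m' x i j = m x i j) ->
     j < N -> I j m' -> eval m' e != 0 /\ wp c (I j.+1) m') ->
  (forall m', (forall x, x \notin writes c -> forall i j, m' x i j = m x i j) ->
     I N m' -> eval m' e = 0) ->
  wp (While e c) (I N) m.
Proof.
move=> NB I0 body stop.
suff gen k j m' : j + k = N -> I j m' ->
    (forall x, x \notin writes c -> forall i j, m' x i j = m x i j) ->
    exists t m1, [/\ t <= (k * (cost B c).+1).+1, I N m1 &
      forall K w, size w = t -> foldl step (While e c :: K, m') w = (K, m1)].
  have [//|t [m1 [tN IN run]]] := gen N 0 m (add0n N) I0; exists t, m1; split=> //.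
  by rewrite (leq_trans tN) //= ltnS leq_mul2r NB orbT.
elim: k j m' => [|k IH] j m'; rewrite ?addn0 => jN Ij fr.
  rewrite jN in Ij; exists 1, m'; split=> // K [|b [|? ?]] //= _.
  by rewrite stop.
have jltN : j < N by rewrite -jN addnS ltnS leq_addr.
have [e0 wc] := body j m' fr jltN Ij.
have [//|s1 [m1 [st1 q run1]]] := wp_sub (Q' := fun m1 => I j.+1 m1 /\
  forall x, x \notin writes c -> forall i j, m1 x i j = m x i j) wc.
  by move=> m1 fr1 I1; split=> // x xc i0 j0; rewrite fr1 // fr.
case: q => I1 fr1.
have [|s2 [m2 [st2 q2 run2]]] := IH j.+1 m1 _ I1 fr1; first by rewrite -jN addnS.
exists (s1 + s2).+1, m2; split=> //; first by rewrite mulSn; lia.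
move=> K [|b w] //= [sw]; rewrite e0.
have [w1 [w2 [sw1 sw2 ->]]] := foldl_split ([:: c, While e c & K], m') sw.
by rewrite run1 // run2.
Qed.

(** The bound [e] is evaluated anew before every iteration, hence the condition that it keeps the
    value [N]. The invariant has to be restored only after the counter is incremented. *)
Lemma wp_for i e c N (I : nat -> memory -> Prop) m :
  N <= B -> I 0 (upd m i 0 0 0) ->
  (forall j m', (forall x, x \notin i :: writes c -> forall i j, m' x i j = m x i j) ->
     j <= N -> m' i 0 0 = j -> I j m' -> eval m' e = N) ->
  (forall j m', (forall x, x \notin i :: writes c -> forall i j, m' x i j = m x i j) ->
     j < N -> m' i 0 0 = j -> I j m' ->
     wp c (fun m1 => m1 i 0 0 = j /\ I j.+1 (upd m1 i 0 0 j.+1)) m') ->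
  wp (For i e c) (I N) m.
Proof.
move=> NB I0 he body.
have frw m' : (forall x, x \notin writes (Seq c (assign i (Add (var i) (lit 1)))) ->
      forall i0 j0, m' x i0 j0 = upd m i 0 0 0 x i0 j0) ->
    forall x, x \notin i :: writes c -> forall i0 j0, m' x i0 j0 = m x i0 j0.
  move=> fr x; rewrite inE negb_or => /andP[xi xc] i0 j0.
  by rewrite fr /= ?mem_cat ?inE ?negb_or ?xi ?xc // /upd (negPf xi).
apply: wp_seq; apply: wp_put.
apply: wp_sub (wp_while (N := N)
    (I := fun j m' => [/\ j <= N, m' i 0 0 = j & I j m']) _ _ _ _) _ => //.
- by split=> //; rewrite /upd !eqxx.
- move=> j m' /frw fr jN [_ mi Ij]; rewrite /= (he j) ?mi //; last exact: ltnW.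
  split; first by lia.
  apply: wp_seq; apply: wp_sub (body j m' fr jN mi Ij) _.
  move=> m1 _ [mi1 I1]; apply: wp_put; rewrite /= mi1 addn1.
  by split=> //; rewrite /upd !eqxx.
- by move=> m' /frw fr [_ mi IN] /=; rewrite (he N) // mi subnn.
- by move=> m' _ [].
Qed.

End WeakestPrecondition.

(** * Walk distances up to a cap *)

Section CappedDistance.
Variables (G : sgraph) (cap : nat).
Implicit Types u v w : 'I_(nv G).

Lemma walkP u v d :
  reflect (exists p, [/\ path (@adj G) u p, last u p = v & size p = d])
          (walk_of_length u v d).
Proof.
apply: (iffP existsP) => [[p /andP[pP /eqP pv]]|[p [pP pv sp]]].
  by exists p; rewrite size_tuple.
have sp' : size p == d by rewrite sp.
by exists (Tuple sp'); rewrite /= pP pv eqxx.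
Qed.

Lemma walk0 u : walk_of_length u u 0.
Proof. by apply/walkP; exists [::]. Qed.

Lemma walk_cat u v w d e :
  walk_of_length u v d -> walk_of_length v w e -> walk_of_length u w (d + e).
Proof.
case/walkP=> p [pP pv <-] /walkP[q [qP qw <-]]; apply/walkP; exists (p ++ q).
by rewrite cat_path last_cat pv pP qP size_cat.
Qed.

Lemma walk1 u v : adj u v -> walk_of_length u v 1.
Proof. by move=> uv; apply/walkP; exists [:: v]; rewrite /= uv. Qed.

Lemma walkS u v d : walk_of_length u v d.+1 ->
  exists2 w, walk_of_length u w d & adj w v.
Proof.
case/walkP=> p; case/lastP: p => [|p x] [] //.
rewrite rcons_path last_rcons size_rcons => /andP[pP xl] <- [sp].
by exists (last u p) => //; apply/walkP; exists p.
Qed.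

Lemma walk_sym u v d : walk_of_length u v d -> walk_of_length v u d.
Proof.
elim: d v => [|d IH] v; first by case/walkP=> -[|? ?] [//= _ -> _]; apply: walk0.
move=> /walkS[w /IH wu wv]; rewrite -addn1 addnC; apply: walk_cat wu.
by apply: walk1; rewrite adj_sym.
Qed.

(** An unsuccessful [find] returns the length [cap] of the list, so this is the minimum of [cap] and
    the distance, also across components. *)
Definition cdist u v := find (walk_of_length u v) (iota 0 cap).

Lemma cdist_le_cap u v : cdist u v <= cap.
Proof. by rewrite (leq_trans (find_size _ _)) // size_iota. Qed.

Lemma cdist_le u v d : walk_of_length u v d -> cdist u v <= d.
Proof.
move=> uv; have [dc|cd] := ltnP d cap; last exact: leq_trans (cdist_le_cap _ _) cd.
rewrite leqNgt; apply: contraL uv => lt.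
by have := before_find 0 lt; rewrite nth_iota // add0n => ->.
Qed.

Lemma cdist_walk u v : cdist u v < cap -> walk_of_length u v (cdist u v).
Proof.
move=> lt; have h : has (walk_of_length u v) (iota 0 cap).
  by rewrite has_find size_iota.
by have := nth_find 0 h; rewrite nth_iota.
Qed.

Lemma cdistxx u : cdist u u = 0.
Proof. by apply/eqP; rewrite -leqn0 cdist_le ?walk0. Qed.

Lemma cdist_sym u v : cdist u v = cdist v u.
Proof. by apply: eq_find => d; apply/idP/idP; apply: walk_sym. Qed.

(** If a summand has reached the cap, it already bounds the left-hand side; otherwise shortest walks
    are concatenated. *)
Lemma cdist_triangle v u w : cdist u w <= cdist u v + cdist v w.
Proof.
have [uv|uv] := ltnP (cdist u v) cap; last first.
  by rewrite (leq_trans (cdist_le_cap u w)) // (leq_trans uv) ?leq_addr.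
have [vw|vw] := ltnP (cdist v w) cap; last first.
  by rewrite (leq_trans (cdist_le_cap u w)) // (leq_trans vw) ?leq_addl.
exact/cdist_le/(walk_cat (cdist_walk uv) (cdist_walk vw)).
Qed.

Lemma cdist_adj v x y : adj x y -> cdist v y <= (cdist v x).+1.
Proof.
move=> xy; rewrite -addn1; apply: leq_trans (cdist_triangle x _ _) _.
by rewrite leq_add2l cdist_le ?walk1.
Qed.

(** Below the cap the truncated distance is the true one. The radius is [j.+1] because [ball] uses a
    strict inequality. *)
Lemma cdist_ball v j : j < cap -> [set w | cdist v w <= j] \subset ball v j.+1.
Proof.
move=> jc; apply/subsetP=> w; rewrite !inE => le.
have /cdist_walk walk : cdist v w < cap by apply: leq_ltn_trans jc.
have con : connect (@adj G) v w.
  by case/walkP: walk => p [pP pw _]; apply/connectP; exists p.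
rewrite /dist; case: {-}_ / idP => [c|//].
by case: ex_minnP => d _ min; rewrite ltnS (leq_trans (min _ walk)).
Qed.

End CappedDistance.

(** * The program *)

Notation vn := 0 (only parsing).
Notation vk := 1 (only parsing).
Notation vadj := 2 (only parsing).
Notation vout := 3 (only parsing).
Notation vK := 4 (only parsing).
Notation vp := 5 (only parsing).
Notation vlg := 6 (only parsing).
Notation vL := 7 (only parsing).
Notation vLam := 8 (only parsing).
Notation vD := 9 (only parsing).
Notation vr := 10 (only parsing).
Notation vb := 11 (only parsing).
Notation vrho := 12 (only parsing).
Notation vgo := 13 (only parsing).
Notation vs := 14 (only parsing).
Notation vN := 15 (only parsing).
Notation vptr := 16 (only parsing).
Notation vcoin := 17 (only parsing).
Notation vrad := 18 (only parsing).
Notation vkap := 19 (only parsing).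
Notation vint := 20 (only parsing).
Notation vall := 21 (only parsing).
Notation vstop := 22 (only parsing).
Notation vrho2 := 23 (only parsing).
Notation vi := 24 (only parsing).
Notation vu := 25 (only parsing).
Notation vv := 26 (only parsing).
Notation vx := 27 (only parsing).

Definition le_test e1 e2 := Defs.Sub (Add e2 (lit 1)) e1.
Definition min_expr e1 e2 := Defs.Sub e1 (Defs.Sub e1 e2).

Lemma le_testP m e1 e2 : (eval m (le_test e1 e2) != 0) = (eval m e1 <= eval m e2).
Proof. by rewrite /=; lia. Qed.

Lemma eval_min m e1 e2 :
  eval m (min_expr e1 e2) = minn (eval m e1) (eval m e2).
Proof. by rewrite /=; lia. Qed.

Section Program.
Variables l C' : nat.

Definition params_cmd :=
  Seq (assign vK (Add (min_expr (Defs.Sub (var vk) (lit 2)) (var vn)) (lit 2)))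
  (Seq (assign vp (lit 1)) (Seq (assign vlg (lit 0))
  (Seq (While (Defs.Sub (var vK) (var vp))
         (Seq (assign vp (Add (var vp) (var vp))) (assign vlg (Add (var vlg) (lit 1)))))
  (Seq (assign vL (scale l (var vlg)))
  (Seq (assign vLam (lit 0))
  (For vi (var vK) (assign vLam (Add (var vLam)
     (scale 5 (Add (scale (2 * C') (var vK)) (Add (scale 2 (var vL)) (lit 2)))))))))))).

Definition relax_cmd :=
  If (Get vadj (var vv) (var vx))
    (Put vD (var vu) (var vx)
       (min_expr (Get vD (var vu) (var vx)) (Add (Get vD (var vu) (var vv)) (lit 1))))
    Skip.

(** One more than the horizon, so that every distance up to the horizon is stored exactly. *)
Definition cap_expr := Add (var vLam) (lit 1).

Definition dists_cmd :=
  Seq (For vu (var vn) (For vv (var vn) (Put vD (var vu) (var vv) cap_expr)))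
  (Seq (For vu (var vn) (Put vD (var vu) (var vu) (lit 0)))
  (For vi cap_expr (For vu (var vn) (For vv (var vn) (For vx (var vn) relax_cmd))))).

(** Tests the doubled radius before it is adopted; the product of ball size and radius is
    accumulated by additions. *)
Definition test_cmd :=
  Seq (assign vrho2 (Add (var vrho) (var vrho)))
  (Seq (assign vgo (le_test (var vrho2) (scale C' (var vK))))
  (For vu (var vn)
    (Seq (assign vs (lit 0))
    (Seq (For vv (var vn)
           (If (le_test (Get vD (var vu) (var vv)) (var vrho2))
              (assign vs (Add (var vs) (var vrho2))) Skip))
     (If (le_test (var vs) (scale C' (var vK))) Skip (assign vgo (lit 0))))))).

Definition search_cmd :=
  Seq (assign vr (lit 1)) (Seq (assign vb (lit 0)) (Seq (assign vrho (var vL)) (Seq test_cmd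
  (While (var vgo)
    (Seq (assign vr (Add (var vr) (var vr))) (Seq (assign vb (Add (var vb) (lit 1)))
    (Seq (assign vrho (Add (var vrho) (var vrho))) test_cmd))))))).

Definition count_cmd :=
  Seq (assign vN (lit 0))
  (Seq (For vu (var vn)
    (Seq (For vi (var vrho) (assign vN (Add (var vN) (var vb))))
         (assign vN (Add (var vN) (var vL)))))
  (assign vptr (lit 0))).

(** [Flip] can write only to a cell [[0,0]], so each coin passes through a scalar before it is
    stored in the array. *)
Definition flip_body :=
  Seq (Flip vall) (Seq (Put vcoin (var vptr) (lit 0) (var vall))
    (assign vptr (Add (var vptr) (lit 1)))).
Definition flips_cmd := While (Defs.Sub (var vN) (var vptr)) flip_body.

Definition scan_cmd e :=
  Seq (assign vall (lit 1))
  (For vx e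
    (Seq (If (Get vcoin (var vptr) (lit 0)) Skip (assign vall (lit 0)))
         (assign vptr (Add (var vptr) (lit 1))))).

(** A block of [b] all-ones coins stops the growth of the radius, which makes it a truncated
    geometric variable. Later blocks are scanned all the same, so the position of a coin does not
    depend on outcomes. *)
Definition radii_cmd :=
  Seq (assign vptr (lit 0))
  (For vu (var vn)
    (Seq (Put vrad (var vu) (lit 0) (lit 1))
    (Seq (assign vstop (lit 0))
    (Seq (For vi (var vrho)
           (Seq (scan_cmd (var vb))
           (Seq (If (var vall) (assign vstop (lit 1)) Skip)
           (If (var vstop) Skip
              (Put vrad (var vu) (lit 0) (Add (Get vrad (var vu) (lit 0)) (lit 1)))))))
    (Seq (scan_cmd (var vL)) (Put vkap (var vu) (lit 0) (var vall))))))).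

(** For the first center that catches the vertex, radius minus distance is nonzero exactly if the
    vertex is interior. *)
Definition interior_cmd :=
  For vx (var vn)
    (Seq (assign vstop (lit 0)) (Seq (Put vint (var vx) (lit 0) (lit 0))
    (For vu (var vn)
      (If (var vstop) Skip
      (If (le_test (Get vD (var vu) (var vx)) (Get vrad (var vu) (lit 0)))
        (Seq (assign vstop (lit 1))
           (Put vint (var vx) (lit 0)
              (Defs.Sub (Get vrad (var vu) (lit 0)) (Get vD (var vu) (var vx)))))
        Skip))))).

(** Each kept vertex in sight counts [r], which avoids a division by [r] in the bound. *)
Definition output_cmd :=
  For vx (var vn)
    (Seq (assign vs (lit 0))
    (Seq (For vu (var vn)
           (If (Get vkap (var vu) (lit 0))
             (If (le_test (Get vD (var vx) (var vu)) (var vLam))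
                (assign vs (Add (var vs) (var vr))) Skip)
             Skip))
    (If (le_test (var vs) (scale 4 (var vK)))
       (Put vout (var vx) (lit 0)
          (Add (Get vint (var vx) (lit 0)) (Get vkap (var vx) (lit 0))))
       (Put vout (var vx) (lit 0) (lit 0))))).

Definition setup_cmd :=
  Seq params_cmd (Seq dists_cmd (Seq search_cmd count_cmd)).
Definition select_cmd := Seq radii_cmd (Seq interior_cmd output_cmd).
Definition cover_cmd := Seq setup_cmd (Seq flips_cmd select_cmd).

End Program.

(** * What the program computes *)

Section Selection.
Variable n : nat.
Variables (D : 'I_n -> 'I_n -> nat) (rad : 'I_n -> nat) (kap : pred 'I_n).

(* Every vertex belongs to the first center u with D u x <= rad u. *)
Definition interior x := [exists u, (D u x < rad u) &&
  [forall v : 'I_n, (v < u) ==> (rad v < D v x)]].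

Definition selected reach r bound x :=
  (#|[set u | kap u && (D x u <= reach)]| * r <= bound) && (interior x || kap x).

End Selection.

Section Specification.
Variables (G : sgraph) (k l C' : nat).
Notation n := (nv G).
Implicit Types (m : memory) (u v : 'I_n).

(* k may be exponential in the size of the input, but a set X has at most nv G
   vertices. *)
Definition kcap := minn (k - 2) n + 2.
(** The parameter L. Its power [2 ^ bits] is the [l]-th power of a power of two above [kcap], hence
    at least [kcap ^ l]. *)
Definition bits := l * up_log 2 kcap.
(** Bounds the total width of [4 * kcap %/ r + 1] annuli for every scale that the search can return,
    so distances can be computed before [r] is known. *)
Definition horizon := kcap * (5 * (2 * C' * kcap + (2 * bits + 2))).
Notation D := (cdist (G := G) horizon.+1).

Definition base m :=
  [/\ m vn 0 0 = n, forall u v, m vadj u v = adj u v :> nat, m vK 0 0 = kcap,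
      m vL 0 0 = bits & m vLam 0 0 = horizon].

Lemma base_fr (V : seq nat) m m' :
  (forall x, x \notin V -> forall i j, m' x i j = m x i j) ->
  all (fun x => x \notin V) [:: vn; vadj; vK; vL; vLam] -> base m -> base m'.
Proof.
move=> fr /and5P[? ? ? ? /andP[? _]] [? ad ? ? ?]; split; rewrite ?fr // => u v.
by rewrite fr.
Qed.

Variable B : nat.
Hypothesis nB : n <= B.
Hypothesis KB : kcap <= B.
Hypothesis lgB : up_log 2 kcap <= B.

Lemma wp_params : wp B (params_cmd l C') base (input G k).
Proof.
have ad u v : input G k vadj u v = adj u v by rewrite /input !valK.
do 3 (apply: wp_seq; apply: wp_put).
have -> : eval (input G k) (Add (min_expr (Defs.Sub (var vk) (lit 2)) (var vn)) (lit 2)) = kcap.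
  rewrite [LHS]/= /kcap; lia.
apply: wp_seq.
apply: wp_sub (wp_while (N := up_log 2 kcap) (I := fun j m =>
  m vp 0 0 = 2 ^ j /\ m vlg 0 0 = j) _ _ _ _) _ => //=.
- move=> j m fr jN [pj lj]; rewrite fr // pj; split.
    rewrite -lt0n subn_gt0 ltnNge; apply: contraL jN => le.
    by rewrite -leqNgt; apply: up_log_min.
  by do 2 (try apply: wp_seq; apply: wp_put); rewrite /upd /= pj lj addnn -mul2n -expnS addn1.
- by move=> m fr [pj lj]; rewrite fr // pj; apply/eqP; rewrite subn_eq0 up_logP.
move=> m fr [pj lj]; do 2 (apply: wp_seq; apply: wp_put).
rewrite /= eval_scale /= lj.
apply: wp_sub (wp_for (N := kcap) (I := fun j m =>
  m vLam 0 0 = j * (5 * (2 * C' * kcap + (2 * bits + 2)))) _ _ _ _) _ => //=.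
- by move=> j m' fr' jN _ _; rewrite fr' //= fr.
- move=> j m' fr' jN mj Ij; apply: wp_put; split=> //=.
  by rewrite eval_scale /= !eval_scale /= Ij !fr' //= !fr //= -/bits; lia.
move=> m' fr' Lam; split=> //; rewrite ?fr' //= ?fr //.
by move=> u v; rewrite fr' //= fr // ad.
Qed.

Hypothesis reachB : horizon < B.

(** * Capped distances by rounds of edge relaxation *)

(** Soundness and completeness of relaxation are kept apart: updates are in place, so entries may
    run ahead of round [t], and an equation for walks of at most [t] edges would fail. *)
Definition dist_bounds t m :=
  (forall u v, m vD u v <= horizon.+1 /\
     (m vD u v < horizon.+1 -> walk_of_length u v (m vD u v))) /\
  (forall u v d, d <= t -> walk_of_length u v d -> m vD u v <= d).

(* What a round of relaxations achieves for a set S of triples (u, v, x). *)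
Definition relaxed t (S : 'I_n -> 'I_n -> 'I_n -> bool) m :=
  forall u v x d, S u v x -> adj v x -> d <= t -> walk_of_length u v d ->
    m vD u x <= d.+1.

(** Entries only decrease, so the triples relaxed earlier stay relaxed while one more joins them. *)
Lemma wp_relax t S m (u v x : 'I_n) (S' : 'I_n -> 'I_n -> 'I_n -> bool) :
  base m -> dist_bounds t m -> relaxed t S m ->
  m vu 0 0 = u -> m vv 0 0 = v -> m vx 0 0 = x ->
  (forall u' v' x', S' u' v' x' -> S u' v' x' \/ [/\ u' = u, v' = v & x' = x]) ->
  wp B relax_cmd (fun m' => dist_bounds t m' /\ relaxed t S' m') m.
Proof.
move=> [_ ad _ _ _] [sound up] rel mu mv mx sub; apply: wp_if => /=;
  rewrite mv mx ad; last first.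
  move/eqP; rewrite eqb0 => nvx; apply: wp_skip; split=> //.
  by move=> u' v' x' d /sub[] => [S'd|[-> -> ->]]; [apply: rel | rewrite (negPf nvx)].
rewrite eqb0 negbK => vx; apply: wp_put.
set e := eval m (min_expr _ _).
have eE : e = minn (m vD u x) (m vD u v).+1.
  by rewrite /e eval_min /= mu mv mx addn1.
have le u' x' : upd m vD u x e vD u' x' <= m vD u' x'.
  rewrite /=; case: ifP => // /andP[/eqP-> /eqP->].
  by rewrite eE geq_minl.
rewrite /= mu mx; split; first split.
- move=> u' x'; rewrite /=; case: ifP => [/andP[/eqP/val_inj-> /eqP/val_inj->]|_]; last exact: sound.
  have [le1 w1] := sound u x; have [le2 w2] := sound u v.
  rewrite eE; split; first by rewrite geq_min le1.
  rewrite /minn; case: ifP => // _ lt; rewrite -addn1; apply: walk_cat (walk1 vx).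
  by apply: w2; apply: ltnW.
- by move=> u' x' d dt w; apply: leq_trans (le u' x') _; apply: up w.
- move=> u' v' x' d /sub[S'd|[-> -> ->]] vx' dt w.
    by apply: leq_trans (le u' x') _; apply: rel w.
  by rewrite /= !eqxx /= eE geq_min ltnS (up _ _ _ dt w) orbT.
Qed.

Lemma dist_bounds_fr t (V : seq nat) m m' :
  (forall x, x \notin V -> forall i j, m' x i j = m x i j) -> vD \notin V ->
  dist_bounds t m -> dist_bounds t m'.
Proof.
move=> fr DV [sound up]; split=> [u v|u v d]; rewrite fr //; exact: up.
Qed.

Lemma relaxed_fr t S (V : seq nat) m m' :
  (forall x, x \notin V -> forall i j, m' x i j = m x i j) -> vD \notin V ->
  relaxed t S m -> relaxed t S m'.
Proof. by move=> fr DV rel u v x d; rewrite fr //; apply: rel. Qed.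

Lemma updF m x i j a y : y != x -> forall i' j', upd m x i j a y i' j' = m y i' j'.
Proof. by move=> yx i' j'; rewrite /= (negPf yx). Qed.

Lemma upd_fr m x i j a y : y \notin [:: x] -> forall i' j', upd m x i j a y i' j' = m y i' j'.
Proof. by rewrite inE; apply: updF. Qed.

Lemma wp_round t m : base m -> dist_bounds t m ->
  wp B (For vu (var vn) (For vv (var vn) (For vx (var vn) relax_cmd)))
    (dist_bounds t.+1) m.
Proof.
move=> bm dm.
(* The triples that precede (j1, j2, j3) in the lexicographic order of the three loops. *)
pose S3 (j1 j2 j3 : nat) (u v x : 'I_n) :=
  (u < j1) || (u == j1 :> nat) && ((v < j2) || (v == j2 :> nat) && (x < j3)).
apply: wp_sub (wp_for (N := n) (I := fun j m =>
  dist_bounds t m /\ relaxed t (S3 j 0 0) m) _ _ _ _) _ => //.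
- split; first exact: dist_bounds_fr (@upd_fr _ _ _ _ _) _ dm.
  by move=> u v x d; rewrite /S3 !ltn0 !andbF.
- by move=> j m' fr _ _ _ /=; rewrite fr //; case: bm.
- move=> j1 m1 fr1 j1n mu1 [d1 r1]; have b1 : base m1 by apply: base_fr fr1 _ bm.
  apply: wp_sub (wp_for (N := n) (I := fun j m =>
    dist_bounds t m /\ relaxed t (S3 j1 j 0) m) _ _ _ _) _ => //.
  + by move=> j m' fr _ _ _ /=; rewrite fr //; case: b1.
  + move=> j2 m2 fr2 j2n mv2 [d2 r2]; have b2 : base m2 by apply: base_fr fr2 _ b1.
    apply: wp_sub (wp_for (N := n) (I := fun j m =>
      dist_bounds t m /\ relaxed t (S3 j1 j2 j) m) _ _ _ _) _ => //.
    * by move=> j m' fr _ _ _ /=; rewrite fr //; case: b2.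
    * move=> j3 m3 fr3 j3n mx3 [d3 r3]; have b3 : base m3 by apply: base_fr fr3 _ b2.
      apply: wp_sub (wp_relax (u := Ordinal j1n) (v := Ordinal j2n) (x := Ordinal j3n)
        (S' := S3 j1 j2 j3.+1) b3 d3 r3 _ _ _ _) _ => //.
      -- by rewrite fr3 // fr2.
      -- by rewrite fr3.
      -- move=> u v x; rewrite /S3 ltnS [x <= _]leq_eqVlt.
         case/orP => [->|]; [by left|case/andP => e1 /orP[lt|]].
           by left; rewrite e1 lt orbT.
         case/andP => e2 /orP[e3|lt]; last by left; rewrite e1 e2 lt !orbT.
         by right; split; apply: val_inj; apply/eqP.
      -- move=> m4 fr4 [d4 r4]; split; first by rewrite fr4.
         by split; [apply: dist_bounds_fr (@upd_fr _ _ _ _ _) _ d4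
                   |apply: relaxed_fr (@upd_fr _ _ _ _ _) _ r4].
    * move=> m3 fr3 [d3 r3]; split; first by rewrite fr3.
      split; first exact: dist_bounds_fr (@upd_fr _ _ _ _ _) _ d3.
      apply: relaxed_fr (@upd_fr _ _ _ _ _) _ _ => //.
      move=> u v x d S'd; apply: r3; move: S'd; rewrite /S3 ltn_ord !andbT ltnS.
      by rewrite ltn0 andbF orbF [v <= _]leq_eqVlt [(v == _ :> nat) || _]orbC.
  + move=> m2 fr2 [d2 r2]; split; first by rewrite fr2.
    split; first exact: dist_bounds_fr (@upd_fr _ _ _ _ _) _ d2.
    apply: relaxed_fr (@upd_fr _ _ _ _ _) _ _ => //.
    move=> u v x d S'd; apply: r2; move: S'd; rewrite /S3 ltn_ord orTb andbT ltnS.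
    by rewrite !ltn0 !andbF orbF [u <= _]leq_eqVlt orbC.
move=> m' _ [[sound up] rel]; split=> // u x d.
rewrite leq_eqVlt ltnS => /orP[/eqP->|]; last exact: up.
(* A walk of [t.+1] edges is a walk of [t] edges followed by an edge that this round has relaxed. *)
by move=> /walkS[v uv vx]; apply: rel uv => //; rewrite /S3 ltn_ord.
Qed.

Definition env m := base m /\ forall u v, m vD u v = D u v.

Lemma env_fr (V : seq nat) m m' :
  (forall x, x \notin V -> forall i j, m' x i j = m x i j) ->
  all (fun x => x \notin V) [:: vD; vn; vadj; vK; vL; vLam] -> env m -> env m'.
Proof.
move=> fr /= /andP[DV bV] [bm dm]; split; first exact: base_fr fr bV bm.
by move=> u v; rewrite fr.
Qed.

Lemma wp_dists m : base m -> wp B dists_cmd env m.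
Proof.
move=> bm; apply: wp_seq.
apply: wp_sub (wp_for (N := n) (I := fun j m =>
  forall u v, u < j -> m vD u v = horizon.+1) _ _ _ _) _ => //.
- by move=> j m' fr _ _ _ /=; rewrite fr //; case: bm.
- move=> j1 m1 fr1 j1n mu1 I1; have b1 : base m1 by apply: base_fr fr1 _ bm.
  apply: wp_sub (wp_for (N := n) (I := fun j m => forall u v,
     (u < j1) || (u == j1 :> nat) && (v < j) -> m vD u v = horizon.+1) _ _ _ _) _ => //.
  + by move=> u v; rewrite ltn0 andbF orbF; apply: I1.
  + by move=> j m' fr _ _ _ /=; rewrite fr //; case: b1.
  + move=> j2 m2 fr2 j2n mv2 I2; have [_ _ _ _ mLam] : base m2 by apply: base_fr fr2 _ b1.
    have mu2 : m2 vu 0 0 = j1 by rewrite fr2.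
    apply: wp_put; split=> //= u v; rewrite mu2 mv2 mLam addn1.
    case: ifP => // ne lt; apply: I2; move: lt ne; rewrite ltnS [v <= _]leq_eqVlt.
    by case: (u < j1) => //=; case: (_ == j1) => //= /orP[->|].
  + move=> m2 fr2 I2; split; first by rewrite fr2.
    by move=> u v /=; rewrite ltnS leq_eqVlt orbC => lt; apply: I2; rewrite ltn_ord andbT.
move=> m1 fr1 I1; have b1 : base m1 by apply: base_fr fr1 _ bm.
apply: wp_seq.
apply: wp_sub (wp_for (N := n) (I := fun j m =>
  forall u v, m vD u v = if (u == v) && (u < j) then 0 else horizon.+1) _ _ _ _) _ => //.
- by move=> u v /=; rewrite ltn0 andbF I1.
- by move=> j m' fr _ _ _ /=; rewrite fr //; case: b1.
- move=> j m2 fr2 jn mu2 I2; apply: wp_put; split=> //= u v.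
  rewrite mu2 ltnS [u <= j]leq_eqVlt I2; case: (eqVneq u v) => [->|/negPf uv] /=.
    by rewrite andbb; case: eqP.
  by rewrite -(inj_eq val_inj) /= in uv; case: (u =P j :> nat) uv => [->|//]; rewrite eq_sym => ->.
move=> m2 fr2 I2; have b2 : base m2 by apply: base_fr fr2 _ b1.
apply: wp_sub (wp_for (N := horizon.+1) (I := fun j m =>
  dist_bounds j m) _ _ _ _) _ => //.
- split=> [u v|u v d] /=; rewrite I2 ltn_ord andbT.
    by case: eqP => [->|_]; split; rewrite ?ltnn // => _; apply: walk0.
  by rewrite leqn0 => /eqP-> /walkP[[|? ?] [//= _ -> _]]; rewrite eqxx.
- by move=> j m' fr _ _ _ /=; rewrite fr //; case: b2 => _ _ _ _ ->; rewrite addn1.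
- move=> j m3 fr3 jn mi3 I3; have b3 : base m3 by apply: base_fr fr3 _ b2.
  apply: wp_sub (wp_round b3 I3) _ => m4 fr4 d4; split; first by rewrite fr4.
  exact: dist_bounds_fr (@upd_fr _ _ _ _ _) _ d4.
move=> m3 fr3 [sound up]; split; first exact: base_fr fr3 _ b2.
move=> u v; have [le w] := sound u v; apply/eqP; rewrite eqn_leq.
have [lt|ge] := ltnP (D u v) horizon.+1.
  by rewrite (up _ _ _ (ltnW lt) (cdist_walk lt)) cdist_le ?w //
    (leq_ltn_trans _ lt) // (up _ _ _ (ltnW lt) (cdist_walk lt)).
(* The distance has reached the cap. An entry below the cap would be the length of a walk, hence no
   smaller than the capped distance. *)
rewrite (leq_trans le ge) /=; move: le; rewrite leq_eqVlt => /orP[/eqP->|/w/cdist_le//].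
exact: cdist_le_cap.
Qed.

(** * Search for the scale of the radii *)

Lemma card_ltS (P : pred 'I_n) v :
  #|[set x : 'I_n | (x < v.+1) && P x]| = #|[set x : 'I_n | (x < v) && P x]| + P v.
Proof.
rewrite (cardsD1 v) inE ltnSn addnC; congr (_ + _); apply: eq_card => x.
by rewrite !inE ltnS [x <= v]leq_eqVlt -(inj_eq val_inj) /=; case: ltngtP.
Qed.

Lemma card_lt0 (P : pred 'I_n) : #|[set x : 'I_n | (x < 0) && P x]| = 0.
Proof. by apply: eq_card0 => x; rewrite inE ltn0. Qed.

Lemma card_ltn (P : pred 'I_n) : #|[set x : 'I_n | (x < n) && P x]| = #|[set x | P x]|.
Proof. by apply: eq_card => x; rewrite !inE ltn_ord. Qed.

(** Passing this test keeps clusters small; failing it bounds the radius from below through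
    polynomial growth. *)
Definition good rho := (rho <= C' * kcap) &&
  [forall u, #|[set v | D u v <= rho]| * rho <= C' * kcap].

(** The exponent at which doubling stops. The range suffices because a power of two exceeds its
    exponent, so the test fails at its end. *)
Definition level := find (fun b => ~~ good (2 ^ b.+1 * bits)) (iota 0 (C' * kcap).+1).

Hypothesis bits0 : 0 < bits.

Lemma level_has : has (fun b => ~~ good (2 ^ b.+1 * bits)) (iota 0 (C' * kcap).+1).
Proof.
apply/hasP; exists (C' * kcap); first by rewrite mem_iota add0n ltnSn.
rewrite /good negb_and -ltnNge (leq_trans _ (leq_pmulr _ bits0)) //.
by rewrite ltnW // ltn_expl.
Qed.

Lemma level_le : level <= C' * kcap.
Proof. by have := level_has; rewrite has_find size_iota. Qed.

Lemma level_bad : ~~ good (2 ^ level.+1 * bits).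
Proof.
by have := nth_find 0 level_has; rewrite nth_iota ?add0n // ltnS level_le.
Qed.

Lemma level_good j : j < level -> good (2 ^ j.+1 * bits).
Proof.
move=> lt; have := before_find 0 lt; rewrite nth_iota; first by move/negbFE.
exact: leq_trans lt (leqW level_le).
Qed.

Lemma wp_test m rho : env m -> m vrho 0 0 = rho ->
  wp B (test_cmd C') (fun m' => (m' vgo 0 0 != 0) = good (rho + rho)) m.
Proof.
move=> em mrho; have [[mn _ mK _ _] mD] := em.
do 2 (apply: wp_seq; apply: wp_put).
rewrite [eval m (Add _ _)]/= mrho; set r2 := rho + rho; set m1 := upd m _ _ _ _.
set go := eval m1 (le_test _ _).
have go1 : (go != 0) = (r2 <= C' * kcap).
  by rewrite /go le_testP /= eval_scale /m1 /= mK.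
apply: wp_sub (wp_for (N := n) (I := fun j m => (m vgo 0 0 != 0) =
  (r2 <= C' * kcap) &&
  [forall u : 'I_n, (u < j) ==> (#|[set v | D u v <= r2]| * r2 <= C' * kcap)]) _ _ _ _) _ => //.
- rewrite /= go1; case: (r2 <= _) => //=; symmetry; exact/forallP.
- by move=> j m' fr _ _ _; rewrite /= fr //= mn.
- move=> j m2 fr2 jn mu2 I2; have m2n : m2 vn 0 0 = n by rewrite fr2.
  have r22 : m2 vrho2 0 0 = r2 by rewrite fr2.
  apply: wp_seq; apply: wp_put; apply: wp_seq.
  apply: wp_sub (wp_for (N := n) (I := fun i m => m vs 0 0 =
    #|[set v : 'I_n | (v < i) && (D (Ordinal jn) v <= r2)]| * r2) _ _ _ _) _ => //.
  + by rewrite card_lt0.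
  + by move=> i m' fr _ _ _; rewrite /= fr.
  + move=> i m3 fr3 iN mv3 I3.
    have mu3 : m3 vu 0 0 = j by rewrite fr3.
    have D3 : m3 vD j i = D (Ordinal jn) (Ordinal iN).
      by rewrite fr3 //= fr2 //= -(mD (Ordinal jn) (Ordinal iN)).
    have r23 : m3 vrho2 0 0 = r2 by rewrite fr3.
    apply: (@wp_ifb _ _ _ _ (D (Ordinal jn) (Ordinal iN) <= r2)) => [|le|le].
    - by rewrite le_testP /= mu3 mv3 D3 r23.
    - apply: wp_put; split=> //=; rewrite I3 (card_ltS _ (Ordinal iN)) le r23.
      by rewrite mulnDl mul1n.
    - by apply: wp_skip; split=> //=; rewrite I3 (card_ltS _ (Ordinal iN)) (negPf le) addn0.
  move=> m3 fr3 s3.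
  have mu3 : m3 vu 0 0 = j by rewrite fr3.
  have K3 : m3 vK 0 0 = kcap by rewrite fr3 //= fr2.
  have g3 : m3 vgo 0 0 = m2 vgo 0 0 by rewrite fr3.
  rewrite card_ltn in s3.
  have all_lt : [forall u : 'I_n, (u < j.+1) ==> (#|[set v | D u v <= r2]| * r2 <= C' * kcap)]
    = (m3 vs 0 0 <= C' * kcap) &&
      [forall u : 'I_n, (u < j) ==> (#|[set v | D u v <= r2]| * r2 <= C' * kcap)].
    apply/forallP/andP => [H|[le /forallP H] u].
      split; first by rewrite s3; apply: (implyP (H (Ordinal jn))) => /=.
      by apply/forallP => u; apply/implyP => lt; apply: (implyP (H u)); apply: ltnW.
    apply/implyP; rewrite ltnS leq_eqVlt => /orP[/eqP uj|]; last exact/implyP.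
    by have -> : u = Ordinal jn; [apply: val_inj | rewrite -s3].
  apply: (@wp_ifb _ _ _ _ (m3 vs 0 0 <= C' * kcap)) => [|le|le].
  - by rewrite le_testP /= eval_scale /= K3.
  - by apply: wp_skip; split=> //=; rewrite g3 I2 all_lt le.
  - by apply: wp_put; split=> //=; rewrite all_lt (negPf le) /= andbF.
move=> m2 fr2 ->; congr (_ && _); apply: eq_forallb => u; by rewrite ltn_ord.
Qed.

Definition scaled m :=
  [/\ m vr 0 0 = 2 ^ level, m vb 0 0 = level & m vrho 0 0 = 2 ^ level * bits].

Hypothesis CB : C' * kcap <= B.

Lemma wp_search m : env m ->
  wp B (search_cmd C') (fun m' => env m' /\ scaled m') m.
Proof.
move=> em; have [[mn _ mK mL _] mD] := em.
do 3 (apply: wp_seq; apply: wp_put).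
rewrite /= mL; set m1 := upd _ _ _ _ _; apply: wp_seq.
have em1 : env m1 by [].
apply: wp_sub (wp_test (rho := bits) em1 _) _ => // m2 fr2 go2.
have em2 : env m2 by apply: env_fr fr2 _ em1.
apply: wp_sub (wp_while (N := level) (I := fun j m =>
  [/\ m vr 0 0 = 2 ^ j, m vb 0 0 = j, m vrho 0 0 = 2 ^ j * bits &
      (m vgo 0 0 != 0) = good (2 ^ j.+1 * bits)]) _ _ _ _) _ => //.
- exact: leq_trans level_le CB.
- by split; [rewrite fr2|rewrite fr2|rewrite fr2 // mul1n|rewrite go2 addnn mul2n].
- move=> j m3 fr3 jl [r3 b3 rho3 go3]; rewrite /= go3 level_good //; split=> //.
  do 3 (apply: wp_seq; apply: wp_put).
  set m4 := upd _ _ _ _ _; have em4 : env m4.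
    by rewrite /m4; have : env m3 by apply: env_fr fr3 _ em2.
  apply: wp_sub (wp_test (rho := 2 ^ j.+1 * bits) em4 _) _.
    by rewrite /m4 /= rho3 expnS -mulnA mul2n addnn.
  move=> m5 fr5 go5; split.
  + by rewrite fr5 // /m4 /= r3 addnn -mul2n -expnS.
  + by rewrite fr5 // /m4 /= b3 addn1.
  + by rewrite fr5 // /m4 /= rho3 expnS -mulnA mul2n addnn.
  + by rewrite go5 addnn -mul2n mulnA -expnS.
- move=> m3 fr3 [_ _ _ go3]; apply/eqP; rewrite -[_ == 0]negbK /= go3.
  exact: level_bad.
move=> m3 fr3 [r3 b3 rho3 _]; split=> //; exact: env_fr fr3 _ em2.
Qed.

Definition ncoins := n * (2 ^ level * bits * level + bits).

Definition ready m := [/\ env m, scaled m, m vN 0 0 = ncoins & m vptr 0 0 = 0].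

(** Either no doubling took place and the radius is [bits], or the last doubling passed the test. *)
Lemma rho_le : 2 ^ level * bits <= C' * kcap + bits.
Proof.
case e: level => [|j]; first by rewrite mul1n leq_addl.
have /level_good/andP[le _] : j < level by rewrite e.
by rewrite (leq_trans le) ?leq_addr.
Qed.

Hypothesis rhoB : C' * kcap + bits <= B.

Lemma wp_count m : env m -> scaled m -> wp B count_cmd ready m.
Proof.
move=> em [mr mb mrho]; have [[mn _ mK mL _] mD] := em.
apply: wp_seq; apply: wp_put; apply: wp_seq.
apply: wp_sub (wp_for (N := n) (I := fun j m => m vN 0 0 =
  j * (2 ^ level * bits * level + bits)) _ _ _ _) _ => //.
- by move=> j m' fr _ _ _; rewrite /= fr //= mn.
- move=> j m2 fr2 jn mu2 I2; apply: wp_seq.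
  apply: wp_sub (wp_for (N := 2 ^ level * bits) (I := fun i m => m vN 0 0 =
    j * (2 ^ level * bits * level + bits) + i * level) _ _ _ _) _ => //.
  + exact: leq_trans rho_le rhoB.
  + by rewrite /= I2 addn0.
  + by move=> i m' fr _ _ _; rewrite /= fr //= fr2.
  + move=> i m3 fr3 iN mi3 I3; apply: wp_put; split=> //=.
    by rewrite I3 fr3 //= fr2 //= mb mulSnr addnA.
  move=> m3 fr3 I3; apply: wp_put; split=> /=; first by rewrite fr3.
  by rewrite I3 fr3 //= fr2 //= mL mulSnr addnA.
move=> m2 fr2 I2; apply: wp_put; split=> //.
- by apply: env_fr fr2 _ em.
- by split; rewrite /= fr2.
Qed.

(** * Decoding coins into radii, kept vertices and the output *)

Definition scan (c : nat -> bool) p e := all (fun i => c (p + i)) (iota 0 e).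

(** Every vertex owns a row of coins: one block of [level] coins for each step of its radius, then
    [bits] coins that decide whether it is kept. *)
Definition rowlen := 2 ^ level * bits * level + bits.

Definition stops c (u : 'I_n) j := scan c (u * rowlen + j * level) level.

Definition radius c u := (find (stops c u) (iota 0 (2 ^ level * bits))).+1.

Definition kept c (u : 'I_n) := scan c (u * rowlen + 2 ^ level * bits * level) bits.

Lemma scanS c p e : scan c p e.+1 = scan c p e && c (p + e).
Proof. by rewrite /scan -addn1 iotaD all_cat /= andbT. Qed.

Lemma wp_scan c p e N m : N <= B ->
  (forall m', (forall x, x \notin [:: vall; vptr; vx] -> forall i j, m' x i j = m x i j) ->
     eval m' e = N) ->
  (forall q, (m vcoin q 0 != 0) = c q) -> m vptr 0 0 = p ->
  wp B (scan_cmd e) (fun m' => (m' vall 0 0 != 0) = scan c p N /\ m' vptr 0 0 = p + N) m.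
Proof.
move=> NB eN mc mp; apply: wp_seq; apply: wp_put.
apply: wp_sub (wp_for (N := N) (I := fun j m =>
  (m vall 0 0 != 0) = scan c p j /\ m vptr 0 0 = p + j) _ _ _ _) _ => //.
- by rewrite /= addn0.
- move=> j m' fr _ _ _; apply: eN => x xV i i'; rewrite fr.
    by rewrite updF //; apply: contraNneq xV => ->.
  by apply: contra xV; rewrite !inE => /or3P[] ->; rewrite ?orbT.
move=> j m2 fr2 jN mx2 [a2 p2]; apply: wp_seq.
have mc2 q : (m2 vcoin q 0 != 0) = c q by rewrite fr2 //= mc.
apply: (@wp_ifb _ _ _ _ (c (p + j))) => [|cp|cp]; first by rewrite /= p2 mc2.
- apply: wp_skip; apply: wp_put; split=> //=; rewrite scanS cp andbT a2 p2.
  by rewrite addn1 addnS.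
- apply: wp_put; apply: wp_put; split=> //=; rewrite scanS (negPf cp) andbF p2.
  by rewrite addn1 addnS.
Qed.

Lemma wp_radii c m : env m -> scaled m -> (forall q, (m vcoin q 0 != 0) = c q) ->
  wp B radii_cmd (fun m' => forall u, m' vrad u 0 = radius c u /\
     (m' vkap u 0 != 0) = kept c u) m.
Proof.
move=> em [mr mb mrho] mc; have [[mn _ mK mL _] mD] := em.
apply: wp_seq; apply: wp_put.
apply: wp_sub (wp_for (N := n) (I := fun j m => m vptr 0 0 = j * rowlen /\
  forall u, u < j -> m vrad u 0 = radius c u /\ (m vkap u 0 != 0) = kept c u)
  _ _ _ _) _ => //.
- by move=> j m' fr _ _ _; rewrite /= fr //= mn.
- move=> j m2 fr2 jn mu2 [p2 I2].
  do 2 (apply: wp_seq; apply: wp_put); apply: wp_seq; rewrite /= mu2.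
  apply: wp_sub (wp_for (N := 2 ^ level * bits) (I := fun i m =>
    [/\ m vptr 0 0 = j * rowlen + i * level,
        (m vstop 0 0 != 0) = has (stops c (Ordinal jn)) (iota 0 i),
        m vrad j 0 = (find (stops c (Ordinal jn)) (iota 0 i)).+1 &
        forall u, u < j -> m vrad u 0 = radius c u]) _ _ _ _) _ => //.
  + exact: leq_trans rho_le rhoB.
  + split=> //=; rewrite ?p2 ?eqxx ?addn0 // => u uj.
    by rewrite (ltn_eqF uj) /=; case: (I2 _ uj).
  + by move=> i m' fr _ _ _; rewrite /= fr //= fr2.
  + move=> i m3 fr3 iN mi3 [p3 s3 rj3 r3]; apply: wp_seq.
    apply: wp_sub (wp_scan (c := c) (p := j * rowlen + i * level) (N := level) _ _ _ _) _ => //.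
    * exact: leq_trans level_le CB.
    * by move=> m' fr; rewrite /= fr //= fr3 //= fr2.
    * by move=> q; rewrite fr3 //= fr2 //= mc.
    move=> m4 fr4 [a4 p4]; apply: wp_seq.
    set S := stops c (Ordinal jn) in s3 rj3 *.
    rewrite -/(stops c (Ordinal jn) i) -/S in a4.
    have mu4 : m4 vu 0 0 = j by rewrite fr4 //= fr3.
    have mi4 : m4 vi 0 0 = i by rewrite fr4.
    have s4 : (m4 vstop 0 0 != 0) = has S (iota 0 i) by rewrite fr4.
    have rj4 : m4 vrad j 0 = (find S (iota 0 i)).+1 by rewrite fr4.
    have r4 u : u < j -> m4 vrad u 0 = radius c u by rewrite fr4 //; apply: r3.
    have p4' : m4 vptr 0 0 = j * rowlen + i.+1 * level by rewrite p4 mulSnr addnA.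
    have hasS : has S (iota 0 i.+1) = has S (iota 0 i) || S i.
      by rewrite -addn1 iotaD has_cat /= orbF.
    (* The index of the first stopping block advances exactly as long as no block has stopped. *)
    have findS : find S (iota 0 i.+1) = find S (iota 0 i) + ~~ has S (iota 0 i.+1).
      rewrite hasS -[i.+1]addn1 iotaD find_cat; case: ifP => [_|no]; first by rewrite addn0.
      move/negbT: no; rewrite has_find size_iota -leqNgt => le.
      have -> : find S (iota 0 i) = i.
        by apply/eqP; rewrite eqn_leq le -{2}(size_iota 0 i) find_size.
      by rewrite /=; case: (S i).
    (* Both branches of the test of [vall] agree outside [vstop], so the update of the radius is
       treated once for both. *)
    suff H m5 : (m5 vstop 0 0 != 0) = has S (iota 0 i.+1) ->
        (forall x, x != vstop -> forall i0 j0, m5 x i0 j0 = m4 x i0 j0) ->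
        wp B (If (var vstop) Skip (Put vrad (var vu) (lit 0)
              (Add (Get vrad (var vu) (lit 0)) (lit 1))))
          (fun m1 => m1 vi 0 0 = i /\ [/\ upd m1 vi 0 0 i.+1 vptr 0 0 = j * rowlen + i.+1 * level,
            (upd m1 vi 0 0 i.+1 vstop 0 0 != 0) = has S (iota 0 i.+1),
            upd m1 vi 0 0 i.+1 vrad j 0 = (find S (iota 0 i.+1)).+1 &
            forall u, u < j -> upd m1 vi 0 0 i.+1 vrad u 0 = radius c u]) m5.
      apply: (@wp_ifb _ _ _ _ (S i)) => [|Si|Si]; first by rewrite /= a4.
        apply: wp_put; apply: H; first by rewrite hasS Si orbT.
        by move=> x xs i0 j0; rewrite updF.
      by apply: wp_skip; apply: H; rewrite // hasS (negPf Si) orbF.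
    move=> s5 fr5; have e1 := fr5 vi isT; have e2 := fr5 vptr isT.
    have e3 := fr5 vrad isT; have e4 := fr5 vu isT.
    apply: (@wp_ifb _ _ _ _ (has S (iota 0 i.+1))) => // h.
      apply: wp_skip; rewrite !updF // e1 e2 e3 rj4 p4' s5; split=> //; split=> //.
        by rewrite findS h addn0.
      by move=> u uj; rewrite updF // e3 r4.
    have ev1 : eval m5 (var vu) = j by rewrite /= e4 mu4.
    have ev2 : eval m5 (Add (Get vrad (var vu) (lit 0)) (lit 1)) = (find S (iota 0 i)).+2.
      by rewrite /= e4 mu4 e3 rj4 addn1.
    apply: wp_put; rewrite ev1 ev2; set m6 := upd m5 _ _ _ _.
    have e6 x : x != vrad -> forall i0 j0, m6 x i0 j0 = m5 x i0 j0 by exact: updF.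
    rewrite (updF _ _ _ _ (x := vi)) // !(updF _ _ _ _ (x := vi)) //.
    rewrite (e6 vi) // (e6 vptr) // (e6 vstop) // e1 e2 s5; split=> //; split=> //.
      by rewrite /m6 /upd !eqxx findS h addn1.
    by move=> u uj; rewrite updF // /m6 /upd eqxx (ltn_eqF uj) /= e3 r4.
  move=> m3 fr3 [p3 s3 rj3 r3]; apply: wp_seq.
  apply: wp_sub (wp_scan (c := c) (N := bits) _ _ _ p3) _ => //.
  + exact: leq_trans (leq_addl _ _) rhoB.
  + by move=> m' fr; rewrite /= fr //= fr3 //= fr2.
  + by move=> q; rewrite fr3 //= fr2 //= mc.
  move=> m4 fr4 [a4 p4]; have mu4 : m4 vu 0 0 = j by rewrite fr4 //= fr3.
  apply: wp_put; rewrite /= mu4; split=> //; split.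
    by rewrite p4 -addnA mulSnr.
  move=> u; rewrite ltnS leq_eqVlt => /orP[/eqP uj|uj].
    have -> : u = Ordinal jn by apply: val_inj.
    by rewrite /= !eqxx /= fr4 //= rj3 a4.
  by rewrite (ltn_eqF uj) /= !fr4 // r3 // fr3 //=; case: (I2 _ uj).
by move=> m2 _ [_ I2] u; apply: I2.
Qed.

Lemma wp_interior rad m : env m -> (forall u : 'I_n, m vrad u 0 = rad u) ->
  wp B interior_cmd (fun m' => forall x : 'I_n, (m' vint x 0 != 0) = interior D rad x) m.
Proof.
move=> em mrad; have [[mn _ _ _ _] mD] := em.
apply: wp_sub (wp_for (N := n) (I := fun j m =>
  forall x : 'I_n, x < j -> (m vint x 0 != 0) = interior D rad x) _ _ _ _) _ => //.
- by move=> j m' fr _ _ _; rewrite /= fr.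
- move=> j m2 fr2 jn mx2 I2; do 2 (apply: wp_seq; apply: wp_put).
  rewrite /= mx2; pose x := Ordinal jn.
  apply: wp_sub (wp_for (N := n) (I := fun i m =>
    [/\ (m vstop 0 0 != 0) = [exists u : 'I_n, (u < i) && (D u x <= rad u)],
        (m vint j 0 != 0) = [exists u : 'I_n, (u < i) && ((D u x < rad u) &&
            [forall v : 'I_n, (v < u) ==> (rad v < D v x)])] &
        forall x : 'I_n, x < j -> (m vint x 0 != 0) = interior D rad x]) _ _ _ _) _ => //.
  + split=> [||y yj].
    * by apply/esym/existsP => -[u]; rewrite ltn0.
    * by rewrite /= eqxx; apply/esym/existsP => -[u]; rewrite ?ltn0.
    * by rewrite /= (ltn_eqF yj) /= I2.
  + by move=> i m' fr _ _ _; rewrite /= fr //= fr2.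
  + move=> i m3 fr3 iN mu3 [s3 i3 I3]; pose u := Ordinal iN.
    have mx3 : m3 vx 0 0 = j by rewrite fr3.
    have r3 : m3 vrad i 0 = rad u by rewrite fr3 //= fr2 // -mrad.
    have D3 : m3 vD i j = D u x by rewrite fr3 //= fr2 // -mD.
    have exS (P : pred 'I_n) : [exists v : 'I_n, (v < i.+1) && P v] =
        [exists v : 'I_n, (v < i) && P v] || P u.
      apply/existsP/orP => [[v]|[/existsP[v /andP[vi Pv]]|Pu]].
      - rewrite ltnS leq_eqVlt => /andP[/orP[/eqP vi|vi] Pv].
          by right; rewrite (_ : u = v) //; apply: val_inj.
        by left; apply/existsP; exists v; rewrite vi.
      - by exists v; rewrite Pv ltnS ltnW.
      - by exists u; rewrite Pu /= ltnSn.
    apply: (@wp_ifb _ _ _ _ [exists v : 'I_n, (v < i) && (D v x <= rad v)]) => // h.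
      apply: wp_skip; split=> //=; rewrite !exS s3 i3 h; split=> //.
      (* An earlier center has caught the vertex, so [u] is not the first to do so. *)
      rewrite [X in _ = _ || X](_ : _ = false) ?orbF //; apply: contraTF h.
      case/andP=> _ /forallP all; rewrite negb_exists; apply/forallP => v.
      by rewrite negb_and -(ltnNge (rad v)) -implybE; auto.
    have all_lt : [forall v : 'I_n, (v < u) ==> (rad v < D v x)].
      apply/forallP=> v; move: h; rewrite negb_exists => /forallP/(_ v).
      by rewrite negb_and -(ltnNge (rad v)) -implybE; auto.
    apply: (@wp_ifb _ _ _ _ (D u x <= rad u)) => [|le|le].
    * by rewrite le_testP /= mu3 mx3 D3 r3.
    * apply: wp_seq; apply: wp_put; apply: wp_put; rewrite /= mu3 mx3 D3 r3.
      split=> //; rewrite !exS le orbT eqxx; split=> // [|y yj].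
        rewrite (_ : [exists v : 'I_n, _] = false) /=; first by rewrite all_lt andbT -lt0n subn_gt0.
        apply: contraNF h => /existsP[v /and3P[vi lt _]]; apply/existsP; exists v.
        by rewrite vi ltnW.
      by rewrite (ltn_eqF yj) /= I3.
    * apply: wp_skip; split=> //=; rewrite !exS s3 i3 (negPf le) orbF; split=> //.
      by rewrite [D u x < _]ltnNge ltnW ?orbF // ltnNge.
  move=> m3 fr3 [_ i3 I3]; split; first by rewrite fr3.
  move=> y; rewrite /= ltnS leq_eqVlt => /orP[/eqP yj|]; last exact: I3.
  have -> : y = x by apply: val_inj.
  rewrite i3; apply: eq_existsb => v; by rewrite ltn_ord.
by move=> m2 _ I2 x; apply: I2.
Qed.

Lemma wp_output rad kap m : env m -> scaled m ->
  (forall x : 'I_n, (m vint x 0 != 0) = interior D rad x) ->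
  (forall u : 'I_n, (m vkap u 0 != 0) = kap u) ->
  wp B output_cmd (fun m' => forall x : 'I_n, (m' vout x 0 != 0) =
    selected D rad kap horizon (2 ^ level) (4 * kcap) x) m.
Proof.
move=> em [mr _ _] mint mkap; have [[mn _ mK _ mLam] mD] := em.
apply: wp_sub (wp_for (N := n) (I := fun j m => forall x : 'I_n, x < j ->
  (m vout x 0 != 0) = selected D rad kap horizon (2 ^ level) (4 * kcap) x) _ _ _ _) _ => //.
- by move=> j m' fr _ _ _; rewrite /= fr.
- move=> j m2 fr2 jn mx2 I2; apply: wp_seq; apply: wp_put.
  pose x := Ordinal jn; apply: wp_seq.
  apply: wp_sub (wp_for (N := n) (I := fun i m => m vs 0 0 =
    #|[set u : 'I_n | (u < i) && (kap u && (D x u <= horizon))]| * 2 ^ level) _ _ _ _) _ => //.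
  + by rewrite card_lt0.
  + by move=> i m' fr _ _ _; rewrite /= fr //= fr2.
  + move=> i m3 fr3 iN mu3 I3; pose u := Ordinal iN.
    have mx3 : m3 vx 0 0 = j by rewrite fr3.
    have k3 : (m3 vkap i 0 != 0) = kap u by rewrite fr3 //= fr2 // -mkap.
    have D3 : m3 vD j i = D x u by rewrite fr3 //= fr2 // -mD.
    have L3 : m3 vLam 0 0 = horizon by rewrite fr3 //= fr2.
    have r3 : m3 vr 0 0 = 2 ^ level by rewrite fr3 //= fr2.
    apply: (@wp_ifb _ _ _ _ (kap u)) => [|ku|ku]; first by rewrite /= mu3.
      apply: (@wp_ifb _ _ _ _ (D x u <= horizon)) => [|le|le].
      * by rewrite le_testP /= mu3 mx3 D3 L3.
      * apply: wp_put; split=> //=; rewrite (card_ltS _ u) ku le I3 r3.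
        by rewrite mulnDl mul1n.
      * by apply: wp_skip; split=> //=; rewrite (card_ltS _ u) (negPf le) andbF addn0.
    by apply: wp_skip; split=> //=; rewrite (card_ltS _ u) (negPf ku) addn0.
  move=> m3 fr3; rewrite card_ltn => s3.
  have mx3 : m3 vx 0 0 = j by rewrite fr3.
  have K3 : m3 vK 0 0 = kcap by rewrite fr3 //= fr2.
  have k3 : (m3 vkap j 0 != 0) = kap x by rewrite fr3 //= fr2 // -mkap.
  have i3 : (m3 vint j 0 != 0) = interior D rad x by rewrite fr3 //= fr2 // -mint.
  have o3 (y : 'I_n) : y < j -> (m3 vout y 0 != 0) = selected D rad kap horizon (2 ^ level) (4 * kcap) y.
    by move=> yj; rewrite fr3 //= I2.
  have fin (a : nat) : (a != 0) = selected D rad kap horizon (2 ^ level) (4 * kcap) x ->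
      forall y : 'I_n, y < j.+1 -> (upd (upd m3 vout j 0 a) vx 0 0 j.+1 vout y 0 != 0)
         = selected D rad kap horizon (2 ^ level) (4 * kcap) y.
    move=> ea y; rewrite /= ltnS leq_eqVlt => /orP[/eqP yj|yj].
      by have -> : y = x; [apply: val_inj | rewrite /= !eqxx].
    by rewrite (ltn_eqF yj) /= o3.
  apply: (@wp_ifb _ _ _ _ (m3 vs 0 0 <= 4 * kcap)) => [|le|le].
  + by rewrite le_testP /= eval_scale /= K3.
  + apply: wp_put; split=> //; rewrite [eval _ (var _)]/= mx3; apply: fin.
    by rewrite /selected -s3 le /= mx3 -i3 -k3 addn_eq0 negb_and.
  + apply: wp_put; split=> //; rewrite [eval _ (var _)]/= mx3; apply: fin.
    by rewrite /selected -s3 (negPf le).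
by move=> m2 _ I2 x; apply: I2.
Qed.

(** * Composition of the phases and the positions of the coins *)

Lemma wp_select c m : env m -> scaled m -> (forall q, (m vcoin q 0 != 0) = c q) ->
  wp B select_cmd (fun m' => forall x : 'I_n, (m' vout x 0 != 0) =
    selected D (radius c) (kept c) horizon (2 ^ level) (4 * kcap) x) m.
Proof.
move=> em sm mc; apply: wp_seq; apply: wp_sub (wp_radii em sm mc) _ => m1 fr1 I1.
have em1 : env m1 by apply: env_fr fr1 _ em.
apply: wp_seq; apply: wp_sub (wp_interior (rad := radius c) em1 _) _.
  by move=> u; case: (I1 u).
move=> m2 fr2 I2; apply: wp_output => //.
- by apply: env_fr fr2 _ em1.
- by case: sm => r2 b2 rho2; split; rewrite fr2 // fr1.
- by move=> u; rewrite fr2 //; case: (I1 u).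
Qed.

Lemma wp_setup : wp B (setup_cmd l C') ready (input G k).
Proof.
apply: wp_seq; apply: wp_sub wp_params _ => m1 _ b1.
apply: wp_seq; apply: wp_sub (wp_dists b1) _ => m2 _ e2.
apply: wp_seq; apply: wp_sub (wp_search e2) _ => m3 _ [e3 s3].
exact: wp_count.
Qed.

(* An iteration takes six steps, the third of which is the flip. *)
Lemma run_flips K d p m w :
  m vN 0 0 = p + d -> m vptr 0 0 = p -> size w = (6 * d).+1 ->
  exists m', [/\ foldl step (flips_cmd :: K, m) w = (K, m'),
    forall x, x \notin [:: vall; vcoin; vptr] -> forall i j, m' x i j = m x i j &
    forall q, m' vcoin q 0 =
      if p <= q < p + d then nth false w (6 * (q - p) + 2) : nat else m vcoin q 0].
Proof.
elim: d p m w => [|d IH] p m w mN mp.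
  case: w => [|b [|? ?]] //= _; rewrite mN mp addn0 subnn; exists m; split=> // q.
  by case: ltngtP.
case: w => [|b0 [|b1 [|b [|b3 [|b4 [|b5 w]]]]]] sw; try by move: sw => /=; lia.
have {}sw : size w = (6 * d).+1 by move: sw; rewrite /=; lia.
rewrite /= mN mp addnS -addSn subSn ?leq_addr //=.
set m1 := upd (upd _ vcoin _ _ _) _ _ _ _.
have [||m' [run fr mc]] := IH p.+1 m1 w _ _ sw; first by rewrite /m1 /= mN addSnnS.
  by rewrite /m1 /= mp addn1.
exists m'; split=> // [x xV i j|q].
  rewrite fr // /m1; move: xV; rewrite !inE !negb_or => /and3P[x1 x2 x3].
  by rewrite !updF.
rewrite mc; case: ltngtP => [pq|qp|e].
- case: ifP => _; last by rewrite /m1 /= mp (gtn_eqF pq).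
  by rewrite (_ : 6 * (q - p) + 2 = (6 * (q - p.+1) + 2).+3.+3) //; lia.
- by rewrite /m1 /= mp (ltn_eqF qp).
- by rewrite -e /m1 /= mp eqxx leq_addr subnn.
Qed.

(** With [s] steps before the loop and six per iteration, coin [q] is drawn at step [s + 6 * q + 2].
    Cells from [ncoins] on are never written and read as [false]. *)
Definition coins (s : nat) (w : seq bool) q :=
  (q < ncoins) && nth false w (s + 6 * q + 2).

(** The setup uses no coin, so the offset [s] is common to all coin sequences and the output depends
    on fixed positions. *)
Lemma run_cover : ncoins <= B -> exists s, s + 6 * ncoins < cost B (cover_cmd l C') /\
  forall w, cost B (cover_cmd l C') <= size w ->
    halted (run (cover_cmd l C') G k w) /\
    output (cover_cmd l C') G k w = [set x | selected D (radius (coins s w))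
      (kept (coins s w)) horizon (2 ^ level) (4 * kcap) x].
Proof.
move=> NB; have [|t0 [m0 [t0c [[em sm mN mp] mc] run0]]] := wp_sub
  (Q' := fun m => ready m /\ forall q, m vcoin q 0 = 0) wp_setup.
  by move=> m fr rm; split=> // q; rewrite fr.
have cE : cost B (cover_cmd l C') =
  (cost B (setup_cmd l C') + ((6 * B).+1 + cost B select_cmd).+1).+1.
  by rewrite [6 * B]mulnC.
(* Besides the [t0] steps of the setup, two [Seq] steps precede the flipping loop. *)
exists (2 + t0); split; first by rewrite cE; lia.
rewrite cE => w sw; set s := 2 + t0; set c := coins s w.
have [[|b0 w0] [w' [sw0 _ e0]]] : exists w0 w', [/\ size w0 = 1 + t0,
    size w' = size w - (1 + t0) & w = w0 ++ w'] => //.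
  by exists (take (1 + t0) w), (drop (1 + t0) w); rewrite cat_take_drop size_drop size_takel //; lia.
have s1 : exists w1 w2, [/\ size w1 = (6 * ncoins).+1 & behead w' = w1 ++ w2].
  exists (take (6 * ncoins).+1 (behead w')), (drop (6 * ncoins).+1 (behead w')).
  rewrite cat_take_drop size_takel // size_behead.
  by move: sw; rewrite e0 size_cat sw0; lia.
have {s1} [w1 [w2 [sw1 e1]]] := s1.
have {e1} [b1 e1] : exists b1, w' = b1 :: w1 ++ w2.
  case: w' e0 e1 => [|b1 w'] e0 e1; last by exists b1; rewrite -e1.
  by move: sw; rewrite e0 size_cat sw0 [size [::]]/=; lia.
have [m1 [run1 fr1 mc1]] := run_flips (p := 0) (w := w1) [:: select_cmd] mN mp sw1.
have mcc q : (m1 vcoin q 0 != 0) = c q.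
  rewrite mc1 mc leq0n add0n /c /coins subn0 /=; case: ifP => //= qN.
  rewrite eqb0 negbK e0 e1 nth_cat sw0 /s ifF; last by lia.
  have -> : 2 + t0 + 6 * q + 2 - (1 + t0) = (6 * q + 2).+1 by lia.
  by rewrite /= nth_cat sw1 ifT //; lia.
have em1 : env m1 by apply: env_fr fr1 _ em.
have sm1 : scaled m1 by case: sm => r2 b2 rho2; split; rewrite fr1.
have [t2 [m2 [t2c out run2]]] := wp_select em1 sm1 mcc.
have [w3 [w4 [sw3 _ e3]]] : exists w3 w4, [/\ size w3 = t2,
    size w4 = size w2 - t2 & w2 = w3 ++ w4].
  exists (take t2 w2), (drop t2 w2); rewrite cat_take_drop size_drop size_takel //.
  by move: sw; rewrite e0 e1 size_cat sw0 [size (_ :: _)]/= size_cat sw1; lia.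
(* A halted machine ignores the remaining coins. *)
have noop m' (v : seq bool) : foldl step ([::], m') v = ([::], m') by elim: v.
have runE : run (cover_cmd l C') G k w = ([::], m2).
  rewrite /run e0 e1 e3 foldl_cat /= run0; last by case: sw0.
  by rewrite /= !foldl_cat run1 run2 ?noop.
by rewrite /output runE; split=> //; apply/setP => x; rewrite !inE out.
Qed.

End Specification.

(** * Treedepth of the selected set *)

Section TreedepthBounds.
Variable G : sgraph.
Implicit Types (S C : {set 'I_(nv G)}) (x y u v : 'I_(nv G)).

Lemma connected_ind (P : 'I_(nv G) -> Prop) C x :
  connected C -> x \in C -> P x ->
  (forall y z, y \in C -> z \in C -> adj y z -> P y -> P z) ->
  forall y, y \in C -> P y.
Proof.
move=> /forall_inP con xC Px step y yC.
have /connectP[p pP ->] := forall_inP (con x xC) y yC.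
elim: p x xC Px pP => //= z p IH x xC Px /andP[/and3P[_ zC xz] pP].
exact: IH zC (step _ _ xC zC xz Px) pP.
Qed.

(** Deleting a kept vertex from a connected set costs one level and lowers the count [t] for all
    that is left; a connected set without kept vertices is bounded by its size. *)
Lemma treedepth_le_kept (kap : pred 'I_(nv G)) S t M :
  (forall C, C \subset S -> connected C -> #|[set x in C | kap x]| <= t /\
     ({in C, forall x, ~~ kap x} -> #|C| <= M)) ->
  treedepth S <= t + M.
Proof.
have [m] := ubnP #|S|; elim: m S t => // m IH S t; rewrite ltnS => Sm bnd.
have [->|S0] := eqVneq S set0; first by rewrite treedepth0.
have [con|dis] := boolP (connected S); last first.
  rewrite treedepth_disconn //; apply/bigmax_leqP => C /imsetP[x xS ->].
  apply: IH => [|C' C'S con]; first exact: leq_trans (component_proper dis xS) Sm.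
  apply: bnd => //; apply: subset_trans C'S _.
  by apply/subsetP => y; rewrite inE => /andP[].
have [leK leM] := bnd S (subxx _) con.
have [/pred0P none|] := boolP (pred0b [pred x in S | kap x]).
  rewrite (leq_trans (treedepth_le S)) // (leq_trans (leM _)) ?leq_addl // => x xS.
  by apply/negbT; have := none x; rewrite /= xS.
case/pred0Pn=> v /andP[/= vS kv].
have [_ /(_ v vS) le] := treedepth_conn S0 con.
have cD : #|[set x in S | kap x]| = #|[set x in S :\ v | kap x]|.+1.
  rewrite (cardsD1 v) inE vS kv; congr _.+1; apply: eq_card => x.
  by rewrite !inE andbA.
case: t leK bnd => [|t] leK bnd; first by rewrite cD in leK.
rewrite (leq_trans le) // addSn ltnS; apply: IH => [|C CS conC].
  by rewrite (leq_trans _ Sm) // [ltnRHS](cardsD1 v) vS.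
split; last by case: (bnd C (subset_trans CS (subD1set _ _)) conC).
rewrite -ltnS (leq_trans _ leK) // cD ltnS; apply/subset_leq_card/subsetP => x.
by rewrite !inE => /andP[/(subsetP CS)]; rewrite !inE => ->.
Qed.

Variables (D : 'I_(nv G) -> 'I_(nv G) -> nat) (rad : 'I_(nv G) -> nat).
Hypothesis Dxx : forall x, D x x = 0.
Hypothesis Dsym : forall x y, D x y = D y x.
Hypothesis Dtri : forall y x z, D x z <= D x y + D y z.
Hypothesis Dadj : forall v x y, adj x y -> D v y <= (D v x).+1.

Definition centered u x :=
  (D u x < rad u) && [forall v : 'I_(nv G), (v < u) ==> (rad v < D v x)].

(** If [u] came before [v], then [D u y <= (D u x).+1 <= rad u], so [u] would catch [y] before [v]
    does. The other order is symmetric. *)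
Lemma centered_adj u v x y : centered u x -> centered v y -> adj x y -> u = v.
Proof.
move=> /andP[ux /forallP xall] /andP[vy /forallP yall] xy; apply: val_inj => /=.
have yx : adj y x by rewrite adj_sym.
case: (ltngtP u v) => // lt.
  have := implyP (yall u) lt; rewrite ltnNge => /negP[].
  exact: leq_trans (Dadj u xy) ux.
have := implyP (xall v) lt; rewrite ltnNge => /negP[].
exact: leq_trans (Dadj v yx) vy.
Qed.

Variables (kap : pred 'I_(nv G)) (rho M reach r bound : nat).
Hypothesis rad_le : forall u, rad u <= rho.+1.
Hypothesis cluster_le : forall u, #|[set x | D u x < rad u]| <= M.
Hypothesis r0 : 0 < r.
Hypothesis reach_ge : (bound %/ r).+1 * (2 * rho + 2) <= reach.

Notation A := [set x | selected D rad kap reach r bound x].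

Lemma cluster_card C : connected C -> {in C, forall x, interior D rad x} ->
  #|C| <= M.
Proof.
move=> con int; have [->|/set0Pn[x0 x0C]] := eqVneq C set0; first by rewrite cards0.
have /existsP[u cu] := int x0 x0C.
apply: leq_trans (cluster_le u); apply/subset_leq_card/subsetP => x xC; rewrite inE.
suff /andP[] : centered u x by [].
apply: (connected_ind (P := centered u) con x0C _ _) xC => // y z yC zC yz uy.
have /existsP[v vz] := int z zC.
by rewrite (centered_adj uy vz yz).
Qed.

(* A cluster has diameter at most 2 * rho, so a connected set that crosses an
   annulus of this width must use a kept vertex in it. *)
Lemma annulus_kept C w m y : connected C -> C \subset A -> w \in C -> kap w ->
  y \in C -> m.+1 * (2 * rho + 2) <= D w y ->
  exists2 z, z \in C & kap z && (D w z %/ (2 * rho + 2) == m).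
Proof.
set s := 2 * rho + 2 => con CA wC kw yC far.
have s0 : 0 < s by rewrite /s addn2.
have [/exists_inP//|/exists_inPn none] := boolP [exists z in C, kap z && (D w z %/ s == m)].
have nkept z : z \in C -> D w z %/ s = m -> interior D rad z.
  move=> zC zm; have := subsetP CA z zC; rewrite inE => /andP[_ /orP[//|kz]].
  by have := none z zC; rewrite kz zm eqxx.
have eqm a : (a %/ s == m) = (m * s <= a) && (a < m.+1 * s).
  by rewrite eqn_leq -ltnS ltn_divLR // leq_divRL // andbC.
(* Along the connected set a vertex is either still before the annulus, or inside it and in the
   cluster of some [z0] on the inner boundary. *)
pose P z := D w z < m * s \/ exists u z0, [/\ centered u z, centered u z0,
  D w z0 = m * s & D w z %/ s = m].
suff : P y.
  case=> [|[u [z0 [_ _ _ /eqP]]]]; last by rewrite eqm ltnNge far andbF.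
  by move=> lt; move: far; rewrite leqNgt mulSn ltn_addl.
apply: (connected_ind (P := P) con wC _ _) yC; rewrite /P.
  (* For [m = 0] the start [w] is itself a kept vertex of the annulus. *)
  rewrite Dxx; case: m {far P eqm} none nkept => [|m] none _; last by left; rewrite muln_gt0 s0.
  by have := none w wC; rewrite kw Dxx div0n eqxx.
move=> x z xC zC xz Px; have [lt|ge] := ltnP (D w z) (m * s); first by left.
right; have adjle := Dadj w xz.
case: Px => [lt|[u [z0 [ux uz0 dz0 xm]]]].
  have e : D w z = m * s by apply/eqP; rewrite eqn_leq ge (leq_trans adjle).
  have zm : D w z %/ s = m by rewrite e mulnK.
  by have /existsP[u cu] := nkept z zC zm; exists u, z.
(* Both [x] and [z0] are within [rho] of [u], so [z] is at most [2 * rho + 1] beyond the inner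
   boundary, still within the width [2 * rho + 2]. *)
have zm : D w z %/ s = m.
  apply/eqP; rewrite eqm ge; apply: leq_trans (_ : (D w x).+2 <= _); first by rewrite ltnS.
  have /andP[Dux _] := ux; have /andP[Duz0 _] := uz0; have rle := rad_le u.
  have t1 := Dtri z0 w x; have t2 := Dtri u z0 x; rewrite [D z0 u]Dsym in t2.
  by rewrite mulSn dz0 in t1 *; rewrite /s; lia.
have /existsP[v vz] := nkept z zC zm.
by exists u, z0; split=> //; rewrite (centered_adj ux vz xz).
Qed.

(** A connected set that leaves the reach of its kept vertex [w] crosses [bound %/ r + 1] annuli
    around [w], each with a kept vertex of its own, more than the selection of [w] permits. So it
    stays within reach, and the selection of [w] bounds its kept vertices. *)
Lemma treedepth_selected : treedepth A <= bound %/ r + M.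
Proof.
apply: (@treedepth_le_kept kap) => C CA con; split; last first.
  move=> nk; apply: cluster_card => // x xC.
  have := subsetP CA x xC; rewrite inE => /andP[_].
  by rewrite (negPf (nk x xC)) orbF.
have [->|/set0Pn[w]] := eqVneq [set x in C | kap x] set0; first by rewrite cards0.
rewrite inE => /andP[wC kw].
have near : #|[set x | kap x && (D w x <= reach)]| <= bound %/ r.
  by have := subsetP CA w wC; rewrite inE leq_divRL // => /andP[].
have [/forall_inP close|] := boolP [forall x in C, D w x <= reach].
  apply: leq_trans near; apply/subset_leq_card/subsetP => x; rewrite !inE.
  by case/andP=> xC ->; apply: close.
case/forall_inPn=> y yC; rewrite -ltnNge => far.
have rge := reach_ge; set s := 2 * rho + 2 in rge.
have ex (m : 'I_(bound %/ r).+1) : exists2 z, z \in C & kap z && (D w z %/ s == m).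
  apply: annulus_kept con CA wC kw yC _; apply: leq_trans (ltnW far).
  by rewrite (leq_trans _ rge) // leq_mul2r ltn_ord orbT.
pose f m := s2val (sig2W (ex m)).
have fP m : kap (f m) && (D w (f m) %/ s == m) by rewrite /f; case: (sig2W _).
have finj : injective f.
  move=> m m' e; apply: val_inj; have /andP[_ /eqP mE] := fP m.
  by have /andP[_ /eqP m'E] := fP m'; rewrite -[RHS]m'E -e.
have : #|[set f m | m in 'I_(bound %/ r).+1]| <= bound %/ r.
  apply: leq_trans near; apply/subset_leq_card/subsetP => x /imsetP[m _ ->].
  have /andP[kf /eqP e] := fP m; rewrite inE kf /=.
  have s0 : 0 < s by rewrite /s addn2.
  apply: leq_trans rge; apply: ltnW; rewrite -ltn_divLR // e.
  exact: ltn_ord.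
by rewrite card_imset // card_ord ltnn.
Qed.

End TreedepthBounds.

(** * Random radii and random kept vertices *)

(** The hypothesis is symmetric, so all fibers have equal size and [h] carries the uniform
    distribution on [S] to that on [B]. *)
Lemma card_equal_fibers (A B : finType) (h : A -> B) (S : {set A}) (P : pred B) :
  (forall y z, #|[set a in S | h a == y]| <= #|[set a in S | h a == z]|) ->
  #|[set a in S | P (h a)]| * #|B| = #|P| * #|S|.
Proof.
move=> le; have split (Q : pred B) y0 : #|[set a in S | Q (h a)]| =
    #|Q| * #|[set a in S | h a == y0]|.
  rewrite -sum1_card (partition_big h Q) /=; last by move=> a; rewrite inE => /andP[].
  rewrite -sum_nat_const; apply: eq_bigr => y Qy.
  have <- : #|[set a in S | h a == y]| = #|[set a in S | h a == y0]|.
    by apply/eqP; rewrite eqn_leq !le.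
  rewrite -sum1_card; apply: eq_bigl => a.
  by rewrite !inE -andbA; case: eqP => [->|]; rewrite ?Qy ?andbF.
case: (pickP P) => [y0 _|P0]; last first.
  rewrite (eq_card0 P0) mul0n; apply/eqP; rewrite muln_eq0 cards_eq0.
  by apply/orP; left; apply/eqP/setP => a; rewrite !inE P0 andbF.
rewrite (split P y0) mulnAC -mulnA -(split predT).
by congr (_ * _); apply: eq_card => a; rewrite inE andbT.
Qed.

(** An event blind to coordinate [j0] is independent of it: overwriting that coordinate maps one
    fiber injectively into another. *)
Lemma card_coordinate (J B : finType) (F : pred {ffun J -> B}) j0 y :
  (forall f g : {ffun J -> B}, (forall j, j != j0 -> f j = g j) -> F f = F g) ->
  #|[set f | F f && (f j0 == y)]| * #|B| = #|[set f | F f]|.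
Proof.
move=> ind; pose up (f : {ffun J -> B}) z := [ffun j => if j == j0 then z else f j].
have Fup f z : F (up f z) = F f.
  by apply: ind => j /negPf jj; rewrite ffunE jj.
have := @card_equal_fibers _ _ (fun f : {ffun J -> B} => f j0) [set f | F f] (pred1 y).
rewrite card1 mul1n => <- => [|y1 y2]; first by congr (_ * _); apply: eq_card => f; rewrite !inE.
rewrite -(@card_in_imset _ _ (up^~ y2)).
  apply/subset_leq_card/subsetP => _ /imsetP[f fP ->].
  by move: fP; rewrite !inE Fup ffunE eqxx eqxx => /andP[->].
move=> f g; rewrite !inE => /andP[_ /eqP fy] /andP[_ /eqP gy] /ffunP e.
apply/ffunP => j; have := e j; rewrite !ffunE.
by case: eqP => [->|//]; rewrite fy gy.
Qed.

(** Coins at distinct positions are independent, so an outcome determined by them bit by bit is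
    uniform. *)
Lemma card_tuple_coordinates (T : nat) (I B : finType) (pos : I -> 'I_T)
    (bit : B -> I -> bool) (h : T.-tuple bool -> B) (P : pred B) :
  injective pos -> (forall y z, bit y =1 bit z -> y = z) ->
  (forall w i, bit (h w) i = tnth w (pos i)) ->
  #|[set w | P (h w)]| * #|B| = #|P| * 2 ^ T.
Proof.
move=> posI bitI hE.
pose up (w : T.-tuple bool) z :=
  [tuple (if [pick i | pos i == t] is Some i then bit z i else tnth w t) | t < T].
have up_pos w z i : tnth (up w z) (pos i) = bit z i.
  rewrite tnth_mktuple; case: pickP => [i' /eqP/posI -> //|/(_ i)].
  by rewrite eqxx.
have := @card_equal_fibers _ _ h [set: T.-tuple bool] P.
rewrite cardsT card_tuple card_bool => <- => [|y z].
  by congr (_ * _); apply: eq_card => w; rewrite !inE.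
rewrite -(@card_in_imset _ _ (up^~ z)).
  apply/subset_leq_card/subsetP => _ /imsetP[w wP ->]; rewrite !inE.
  by apply/eqP/bitI => i; rewrite hE up_pos.
move=> w1 w2; rewrite !inE => /eqP e1 /eqP e2 e; apply: eq_from_tnth => t.
have := congr1 (fun w => tnth w t) e; rewrite /= !tnth_mktuple.
by case: pickP => // i /eqP <- _; rewrite -!hE e1 e2.
Qed.

(** * Bernoulli inequalities without denominators *)

Lemma bernoulli_add a m : (a + m) * a ^ m <= a * a.+1 ^ m.
Proof.
elim: m => [|m IH]; first by rewrite addn0 !expn0.
rewrite !expnS; have := leq_mul (leqnn a.+1) IH; nia.
Qed.

Lemma bernoulli_sub q m : (q - m) * q ^ m <= q * q.-1 ^ m.
Proof.
elim: m => [|m IH]; first by rewrite subn0 !expn0.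
rewrite !expnS; have := leq_mul (leqnn q.-1) IH.
case: q {IH} => [|q] //=; nia.
Qed.

(** This is (1 - 1/r)^r <= 1/2, from Bernoulli's inequality for the base 1 + 1/(r-1) and exponent
    r. *)
Lemma expn_pred_le r : 0 < r -> 2 * r.-1 ^ r <= r ^ r.
Proof.
case: r => [|[|s]] // _; rewrite /=.
have := bernoulli_add s.+1 s.+2; rewrite [X in _ * X <= _]expnS.
set x := _ ^ s.+1; set y := _ ^ s.+2 => h.
have : s.+1 * ((s.+1 + s.+2) * x) <= s.+1 * y by nia.
rewrite leq_pmul2l //; rewrite expnS -/x; nia.
Qed.

(** This is (1 - 1/q)^m >= 1 - m/q >= 1/2. *)
Lemma expn_pred_ge q m : 0 < q -> 2 * m <= q -> q ^ m <= 2 * q.-1 ^ m.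
Proof.
move=> q0 mq; have := bernoulli_sub q m => h.
have : q * q ^ m <= q * (2 * q.-1 ^ m).
  apply: leq_trans (_ : 2 * ((q - m) * q ^ m) <= _); last by rewrite [q * (2 * _)]mulnCA leq_mul2l h orbT.
  by rewrite mulnA leq_mul2r; apply/orP; right; lia.
by rewrite leq_pmul2l.
Qed.

Lemma sum_card_exchange (T I : finType) (E : I -> {set T}) :
  \sum_i #|E i| = \sum_x #|[set i | x \in E i]|.
Proof.
transitivity (\sum_i \sum_(x in E i) 1); first by apply: eq_bigr => i _; rewrite sum1_card.
rewrite (exchange_big_dep predT) //=; apply: eq_bigr => x _.
by rewrite sum1_card; apply: eq_card => i; rewrite inE.
Qed.

(** * Cut probabilities for truncated geometric radii *)

Section RandomRadii.
Variables (n b L : nat) (D : 'I_n -> 'I_n -> nat).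
Notation r := (2 ^ b).
Notation rho := (r * L).
Notation block := {ffun 'I_b -> bool}.
Notation ones := ([ffun=> true] : block).
Notation radii := {ffun 'I_n * 'I_rho -> block}.
Implicit Types (f g : radii) (u v x : 'I_n).

Lemma card_block : #|{: block}| = r.
Proof. by rewrite card_ffun card_bool card_ord. Qed.

(** Without an all-ones block [find] returns [rho], which truncates the geometric variable at
    [rho.+1]. *)
Definition draw f u := (find (fun j => f (u, j) == ones) (enum 'I_rho)).+1.

Lemma rad_le f u : draw f u <= rho.+1.
Proof. by rewrite ltnS (leq_trans (find_size _ _)) // size_enum_ord. Qed.

Lemma rad_gt f u d : d <= rho ->
  (d < draw f u) = [forall j : 'I_rho, (j < d) ==> (f (u, j) != ones)].
Proof.
move=> dr; rewrite ltnS; apply/idP/forallP => [le j|all].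
  apply/implyP=> jd; have := before_find j (leq_trans jd le).
  by rewrite nth_ord_enum => ->.
rewrite leqNgt; apply/negP => lt.
have h : has (fun j => f (u, j) == ones) (enum 'I_rho).
  by rewrite has_find size_enum_ord (leq_trans lt).
have fr : find (fun j => f (u, j) == ones) (enum 'I_rho) < rho := leq_trans lt dr.
have j0 := Ordinal fr; have := implyP (all (Ordinal fr)) lt.
by have := nth_find j0 h; rewrite -[find _ _]/(val (Ordinal fr)) nth_ord_enum => ->.
Qed.

Lemma rad_gtS f u (j : 'I_rho) :
  (j.+1 < draw f u) = (j < draw f u) && (f (u, j) != ones).
Proof.
rewrite !rad_gt //; last exact: ltnW.
apply/forallP/andP => [all|[/forallP all fj] i].
  split; last exact: (implyP (all j)).
  by apply/forallP => i; apply/implyP => ij; apply: (implyP (all i)); apply: ltnW.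
apply/implyP; rewrite ltnS leq_eqVlt => /orP[/eqP ij|]; last exact/implyP.
by rewrite (val_inj ij).
Qed.

Lemma rad_eqS f u (j : 'I_rho) :
  (j.+1 == draw f u) = (j < draw f u) && (f (u, j) == ones).
Proof.
by rewrite eqn_leq [draw f u <= _]leqNgt rad_gtS negb_and negbK; case: (_ < _).
Qed.

Lemma eq_rad f g u : (forall j, f (u, j) = g (u, j)) -> draw f u = draw g u.
Proof. by move=> e; congr _.+1; apply: eq_find => j; rewrite e. Qed.

Definition uncaught f u x := [forall v : 'I_n, (v < u) ==> (draw f v < D v x)].

Lemma eq_uncaught f g u x :
  (forall v j, v < u -> f (v, j) = g (v, j)) -> uncaught f u x = uncaught g u x.
Proof.
move=> e; apply: eq_forallb => v; case: ltnP => //= lt.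
by rewrite (@eq_rad f g) // => j; apply: e.
Qed.

(** Memorylessness: given that [u] is the first to catch [x], equality depends only on block [j] of
    [u], which is independent of that condition. *)
Lemma card_cut_center u x (j : 'I_rho) : D u x = j.+1 ->
  #|[set f | (D u x == draw f u) && uncaught f u x]| * r =
  #|[set f | (D u x <= draw f u) && uncaught f u x]|.
Proof.
move=> ->.
have := @card_coordinate _ _ (fun f : radii => (j < draw f u) && uncaught f u x) (u, j) ones.
rewrite card_block => <- => [|f g e].
  by congr (_ * _); apply: eq_card => f; rewrite !inE rad_eqS andbAC.
rewrite (@eq_uncaught f g) => [|v i vu].
  rewrite !rad_gt; [|exact: ltnW..]; congr (_ && _).
  apply: eq_forallb => i; case: ltnP => //= ij; rewrite e //.
  by rewrite xpair_eqE eqxx -(inj_eq val_inj) /= ltn_eqF.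
by apply: e; rewrite xpair_eqE -(inj_eq val_inj) /= ltn_eqF.
Qed.

(** The geometric tail (1 - 1/r)^m, one independent block at a time. *)
Lemma card_rad_gt u m : m <= rho ->
  #|[set f | m < draw f u]| * r ^ m = #|{: radii}| * r.-1 ^ m.
Proof.
elim: m => [|m IH] mr.
  by rewrite !expn0; congr (_ * _); apply: eq_card => f; rewrite inE.
have {}IH := IH (ltnW mr); pose j := Ordinal mr.
have split : #|[set f | m < draw f u]| =
    #|[set f | m.+1 < draw f u]| + #|[set f | (m < draw f u) && (f (u, j) == ones)]|.
  rewrite -(cardsID [set f : radii | f (u, j) == ones]) addnC; congr (_ + _); apply: eq_card => f.
    by rewrite !inE (rad_gtS f u j) andbC.
  by rewrite !inE.
have ind := @card_coordinate _ _ (fun f : radii => m < draw f u) (u, j) ones.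
rewrite card_block in ind; have {}ind := ind _.
have indep : #|[set f | (m < draw f u) && (f (u, j) == ones)]| * r = #|[set f | m < draw f u]|.
  apply: ind => f g e; rewrite !rad_gt ?(ltnW mr) //.
  apply: eq_forallb => i; case: ltnP => //= ij; rewrite e //.
  by rewrite xpair_eqE eqxx -(inj_eq val_inj) /= ltn_eqF.
have r0 : 0 < r by rewrite expn_gt0.
have step : #|[set f | m.+1 < draw f u]| * r = #|[set f | m < draw f u]| * r.-1.
  move: split indep; move: #|[set f | m.+1 < _]| #|[set f | m < _]| #|[set f | _ && _]|.
  by move=> N1 N2 N3 -> e; rewrite -subn1 mulnBr muln1 mulnDl e addnK.
by rewrite !expnS mulnA step mulnAC IH -mulnA [_ * r.-1]mulnC.
Qed.

Lemma card_rad_max u : #|[set f | rho < draw f u]| * 2 ^ L <= #|{: radii}|.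
Proof.
have r0 : 0 < r by rewrite expn_gt0.
rewrite -(@leq_pmul2r (r ^ rho)) ?expn_gt0 ?r0 // mulnAC card_rad_gt //.
rewrite -mulnA leq_mul2l; apply/orP; right.
rewrite (expnM _.-1) (expnM r) -expnMn mulnC.
by case: L => [//|L']; rewrite leq_exp2r // expn_pred_le.
Qed.

Hypothesis Dxx : forall x, D x x = 0.

Definition cut f x := ~~ interior D (draw f) x.

(** Every vertex is caught, at least by itself; the first center to catch a cut vertex does so with
    equality. *)
Lemma cut_center f x : cut f x ->
  exists u, (D u x == draw f u) && uncaught f u x.
Proof.
move=> cx; have caught : D x x <= draw f x by rewrite Dxx.
case: (@arg_minnP _ x (fun u => D u x <= draw f u) val caught) => u le min; exists u.
have unc : uncaught f u x.
  apply/forallP => v; apply/implyP; apply: contraLR; rewrite -leqNgt -leqNgt.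
  exact: min.
rewrite unc andbT eqn_leq le leqNgt; apply: contra cx => lt.
by apply/existsP; exists u; rewrite lt.
Qed.

(* The events "u is the first center that catches x" are disjoint. *)
Lemma sum_card_caught x :
  \sum_u #|[set f | (D u x <= draw f u) && uncaught f u x]| <= #|{: radii}|.
Proof.
pose S u := [set f | (D u x <= draw f u) && uncaught f u x].
rewrite -/(S _) (sum_card_exchange S) -[leqRHS]sum1_card; apply: leq_sum => f _.
apply/card_le1P => u; rewrite !inE => /andP[uc /forallP uu] v.
rewrite !inE; apply/andP/eqP => [[vc /forallP vu]|->]; last by split=> //; apply/forallP.
apply: val_inj => /=; case: (ltngtP v u) => // lt.
  by have := implyP (uu v) lt; rewrite ltnNge vc.
by have := implyP (vu u) lt; rewrite ltnNge uc.
Qed.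

(** Union bound over the center that cuts [x]. The disjoint catching events contribute 1/r in total,
    and centers at distance [rho.+1], which need a truncated radius, contribute at most 1/r more. *)
Lemma card_cut x : #|[set u | D u x == rho.+1]| * r <= 2 ^ L ->
  #|[set f | cut f x]| * r <= 2 * #|{: radii}|.
Proof.
move=> far; pose E u := [set f | (D u x == draw f u) && uncaught f u x].
pose F u := [set f | (D u x <= draw f u) && uncaught f u x].
have cardE u : #|E u| * r <= #|F u| + (D u x == rho.+1) * r * #|[set f | rho < draw f u]|.
  case e: (D u x) => [|d].
    (* Radii are positive, so a center at distance zero never cuts. *)
    rewrite (_ : E u = set0) ?cards0 //; apply/setP => f; rewrite !inE e.
    by rewrite /draw.
  have [lt|gt|dr] := ltngtP d rho.
  - by have := @card_cut_center u x (Ordinal lt) e; rewrite -/(E u) => ->; rewrite leq_addr.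
  - rewrite (_ : E u = set0) ?cards0 //; apply/setP => f; rewrite !inE e.
    rewrite (gtn_eqF (m := draw f u)) //; exact: leq_ltn_trans (rad_le f u) _.
  - rewrite dr eqxx mul1n mulnC (leq_trans _ (leq_addl _ _)) // leq_mul2l.
    apply/orP; right; apply/subset_leq_card/subsetP => f; rewrite !inE e dr.
    by case/andP => /eqP <-.
have le1 : #|[set f | cut f x]| <= \sum_u #|E u|.
  rewrite sum_card_exchange -sum1_card big_mkcond; apply: leq_sum => f _.
  rewrite inE; case: ifP => // /cut_center[u uP].
  by rewrite card_gt0; apply/set0Pn; exists u; rewrite !inE.
apply: leq_trans (leq_mul le1 (leqnn r)) _; rewrite big_distrl /=.
apply: leq_trans (leq_sum _ (fun u _ => cardE u)) _.
rewrite big_split mul2n -addnn leq_add ?sum_card_caught //=.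
have le2 u : (D u x == rho.+1) * r * #|[set f | rho < draw f u]| * 2 ^ L <=
    (D u x == rho.+1) * r * #|{: radii}|.
  by rewrite -!mulnA leq_mul2l leq_mul2l card_rad_max !orbT.
rewrite -(@leq_pmul2r (2 ^ L)) ?expn_gt0 // big_distrl /=.
apply: leq_trans (leq_sum _ (fun u _ => le2 u)) _.
rewrite -!big_distrl /= mulnC leq_mul2l; apply/orP; right; apply: leq_trans far.
rewrite leq_mul2r -sum1_card [X in _ <= X]big_mkcond leq_sum ?orbT // => u _.
by rewrite inE; case: eqP.
Qed.

(** * Success probability over radii and kept vertices *)

Section RandomCover.
Variables (X : {set 'I_n}) (K : nat).
Hypothesis K0 : 0 < K.
Hypothesis XK : #|X| <= K.
Hypothesis far_le : forall x, #|[set u | D u x == rho.+1]| * r <= 2 ^ L.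

Notation cuts f := [set x in X | cut f x].

(** Markov's inequality: the expected number of cuts is at most 2K/r, so 4K/r is exceeded with
    probability at most 1/2. *)
Lemma card_few_cuts :
  #|{: radii}| <= 2 * #|[set f | #|cuts f| * r <= 4 * K]|.
Proof.
pose bad := [set f | 4 * K < #|cuts f| * r].
have cutsE f x : (x \in cuts f) = (x \in X) && cut f x by rewrite inE.
have total : \sum_f #|cuts f| * r <= 2 * K * #|{: radii}|.
  rewrite -big_distrl (sum_card_exchange (fun f => cuts f)) /=.
  rewrite (bigID (mem X)) /= [X in _ + X]big1 ?addn0 => [|x /negPf xX]; last first.
    by apply: eq_card0 => f; rewrite !inE xX.
  rewrite big_distrl; apply: leq_trans (_ : \sum_(x in X) 2 * #|{: radii}| <= _).
    apply: leq_sum => x xX; apply: leq_trans (card_cut (far_le x)).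
    rewrite leq_mul2r; apply/orP; right; apply/subset_leq_card/subsetP => f.
    by rewrite !inE => /andP[].
  by rewrite sum_nat_const mulnA leq_mul2r [#|X| * 2]mulnC leq_mul2l XK !orbT.
have markov : #|bad| * (4 * K) <= \sum_f #|cuts f| * r.
  rewrite -sum_nat_const [leqRHS](bigID (mem bad)) /=; apply: leq_trans (leq_addr _ _).
  by apply: leq_sum => f; rewrite inE => /ltnW.
have half : 2 * #|bad| <= #|{: radii}|.
  have K2 : 0 < 2 * K by rewrite muln_gt0.
  by rewrite -(leq_pmul2l K2) (leq_trans _ total) // (leq_trans _ markov) //; lia.
have <- : ~: bad = [set f | #|cuts f| * r <= 4 * K].
  by apply/setP => f; rewrite !inE -leqNgt.
by rewrite -(cardsC bad) in half *; lia.
Qed.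

Variables (a reach : nat).
Notation keeps := {ffun 'I_n -> {ffun 'I_a -> bool}}.
Implicit Types (h : keeps).

Definition kap h u := h u == [ffun=> true].

(** By independence the prescribed choice has probability 2^(-a #|Z|) times (1 - 2^-a)^#|Y :\: Z|,
    and the second factor is at least 1/2 by the size of [Y]. *)
Lemma card_keep_exactly (Y Z : {set 'I_n}) : Z \subset Y -> 2 * #|Y| <= 2 ^ a ->
  #|{: keeps}| <= 2 * 2 ^ (a * #|Z|) *
    #|[set h : keeps | [forall y in Y, kap h y == (y \in Z)]]|.
Proof.
move=> ZY Ya; set q := 2 ^ a.
have q0 : 0 < q by rewrite expn_gt0.
have card_row : #|{: {ffun 'I_a -> bool}}| = q by rewrite card_ffun card_bool card_ord.
(* The rows allowed at [v]: all ones on [Z], anything else on the rest of [Y], no constraint outside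
   [Y]. *)
pose F v : {set {ffun 'I_a -> bool}} :=
  if v \in Y then if v \in Z then [set [ffun=> true]] else ~: [set [ffun=> true]]
  else setT.
have -> : #|[set h : keeps | [forall y in Y, kap h y == (y \in Z)]]| = \prod_v #|F v|.
  transitivity #|family F|; last by rewrite card_family foldrE big_image.
  apply: eq_card => h; rewrite inE; apply/forall_inP/familyP => hP v.
    rewrite /F; case: ifP => [vY|_]; last by rewrite inE.
    by have := hP v vY; rewrite /kap; case: ifP => _ /eqP e; rewrite !inE e.
  move=> vY; have := hP v; rewrite /F vY /kap; case: ifP => _; rewrite !inE.
    by move=> ->.
  by move/negPf=> ->.
have prodE : q ^ #|Z| * \prod_v #|F v| = q.-1 ^ #|Y :\: Z| * q ^ #|~: (Y :\: Z)|.
  rewrite -sum1_card expn_sum [X in X * _]big_mkcond -big_split /=.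
  rewrite (bigID (mem (Y :\: Z))) /= -!prod_nat_const; congr (_ * _).
    apply: eq_bigr => v; rewrite inE => /andP[/negPf vZ vY].
    by rewrite vZ mul1n /F vY vZ cardsCs setCK cards1 card_row subn1.
  rewrite [RHS](eq_bigl (fun v => v \notin Y :\: Z)) => [|v]; last by rewrite inE.
  apply: eq_bigr => v; rewrite inE negb_and negbK /F => /orP[vZ|/negPf vY].
    by rewrite vZ (subsetP ZY v vZ) cards1 muln1.
  rewrite vY cardsT card_row; case: ifP => [vZ|]; last by rewrite mul1n.
  by have := subsetP ZY v vZ; rewrite vY.
rewrite expnM -/q -mulnA prodE card_ffun card_row mulnA.
rewrite -(cardC (mem (Y :\: Z))) expnD leq_mul //.
  by rewrite expn_pred_ge // (leq_trans _ Ya) // leq_mul2l subset_leq_card // subsetDl.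
by rewrite leq_eqVlt; apply/orP; left; apply/eqP; congr (_ ^ _); apply: eq_card => v; rewrite !inE.
Qed.

Hypothesis near_le : 2 * #|[set u | [exists x in X, D x u <= reach]]| <= 2 ^ a.

(** Half of the radii cut few vertices of [X]. If exactly the cut vertices of [X] are kept within
    [reach] of [X], then each vertex of [X] is interior or kept and sees few kept ones. Both
    halvings together give the factor 4. *)
Lemma card_success : #|{: radii}| * #|{: keeps}| <=
  4 * 2 ^ (a * ((4 * K) %/ r)) * #|[set y : radii * keeps |
    X \subset [set x | selected D (draw y.1) (kap y.2) reach r (4 * K) x]]|.
Proof.
have nearY := near_le; set Y := [set u | _] in nearY; set S := [set y | _].
have r0 : 0 < r by rewrite expn_gt0.
pose few := [set f | #|cuts f| * r <= 4 * K].
pose H f := [set h : keeps | [forall y in Y, kap h y == (y \in cuts f)]].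
have cutsY f : cuts f \subset Y.
  apply/subsetP => x; rewrite !inE => /andP[xX _].
  by apply/exists_inP; exists x; rewrite // Dxx.
have sub f h : f \in few -> h \in H f -> (f, h) \in S.
  rewrite !inE => few_f /forall_inP hP; apply/subsetP => x xX; rewrite inE /=.
  apply/andP; split.
    apply: leq_trans few_f; rewrite leq_mul2r; apply/orP; right.
    apply/subset_leq_card/subsetP => u; rewrite !inE => /andP[ku near].
    have uY : u \in Y by rewrite inE; apply/exists_inP; exists x.
    by move: (hP u uY); rewrite ku inE => /eqP <-.
  have xY : x \in Y by rewrite inE; apply/exists_inP; exists x; rewrite // Dxx.
  move: (hP x xY) => /eqP ->; rewrite inE xX /= /cut; exact: orbN.
have cardS : \sum_(f in few) #|H f| <= #|S|.
  rewrite -sum1_card (eq_bigr (fun f => \sum_(h in H f) 1)) => [|f _]; last by rewrite sum1_card.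
  rewrite pair_big_dep /= [leqRHS]big_mkcond [leqLHS]big_mkcond.
  apply: leq_sum => -[f h] _; case: ifP => // /andP[ff hh].
  by rewrite /= sub.
apply: leq_trans (leq_mul (leqnn _) cardS).
apply: leq_trans (leq_mul card_few_cuts (leqnn _)) _; rewrite -/few.
rewrite -mulnA -sum1_card big_distrl big_distrr [leqRHS]big_distrr /=.
apply: leq_sum => f; rewrite inE => ff; rewrite mul1n.
apply: leq_trans (leq_mul (leqnn 2) (card_keep_exactly (cutsY f) nearY)) _.
rewrite -/(H f) !mulnA leq_mul2r; apply/orP; right.
by rewrite leq_mul2l leq_exp2l // leq_mul2l leq_divRL // ff !orbT.
Qed.

End RandomCover.
End RandomRadii.

(** * Correctness of the program *)

Lemma leq_expn2 a b e : a <= b -> a ^ e <= b ^ e.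
Proof. by case: e => // e ab; rewrite leq_exp2r. Qed.

Section Correctness.
Variables (G : sgraph) (k l C0 d : nat).
Notation n := (nv G).
Notation C' := (C0 * 2 ^ d).
Notation K := (kcap G k).
Notation len := (bits G k l).
Notation reach := (horizon G k l C').
Notation level := (level G k l C').
Notation r := (2 ^ level).
Notation rho := (r * len).
Notation rowlen := (rowlen G k l C').
Notation ncoins := (ncoins G k l C').
Notation D := (cdist (G := G) reach.+1).

Hypothesis C0_gt0 : 0 < C0.
Hypothesis l_gt0 : 0 < l.
Hypothesis growth : forall j, 0 < j -> forall v : 'I_n, #|ball v j| <= C0 * j ^ d.
Hypothesis l_large : 2 * (C' * K * (C0 * (reach + 2) ^ d)) <= 2 ^ len.

Lemma K_ge2 : 1 < K.
Proof. by rewrite /kcap addn2. Qed.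

Lemma C'_gt0 : 0 < C'.
Proof. by rewrite muln_gt0 C0_gt0 expn_gt0. Qed.

Lemma len_gt0 : 0 < len.
Proof. by rewrite /bits muln_gt0 l_gt0 up_log_gt0 K_ge2. Qed.

Lemma r_gt0 : 0 < r.
Proof. by rewrite expn_gt0. Qed.

Lemma r_le : r <= C' * K.
Proof.
case e: level => [|j]; first by rewrite muln_gt0 C'_gt0 ltnW ?K_ge2.
have /(level_good len_gt0)/andP[le _] : j < level by rewrite e.
by apply: leq_trans le; rewrite leq_pmulr ?len_gt0.
Qed.

Lemma reach_ge : (4 * K %/ r).+1 * (2 * rho + 2) <= reach.
Proof.
have K2 := K_ge2; have rl := @rho_le G k l C' len_gt0.
apply: leq_trans (_ : (5 * K) * (2 * (C' * K + len) + 2) <= _).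
  apply: leq_mul; last by rewrite leq_add2r leq_mul2l.
  by have := leq_div (4 * K) r; lia.
rewrite /horizon; lia.
Qed.

Lemma rho_lt_reach : rho.+1 < reach.
Proof.
apply: leq_trans reach_ge; rewrite mulSn; apply: leq_trans (leq_addr _ _); lia.
Qed.

Lemma cdist_card v j : j <= reach -> #|[set w | D v w <= j]| <= C0 * j.+1 ^ d.
Proof.
move=> jr; apply: leq_trans (growth (ltn0Sn j) v).
by apply/subset_leq_card/cdist_ball.
Qed.

(** Growth leaves only polynomially many vertices within the horizon, and [l_large] puts [2 ^ len]
    above [r] times that number. *)
Lemma far_le x : #|[set u | D u x == rho.+1]| * r <= 2 ^ len.
Proof.
apply: leq_trans l_large; rewrite mul2n -addnn; apply: leq_trans (leq_addr _ _).
rewrite [leqRHS]mulnC; apply: leq_mul r_le.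
apply: leq_trans (_ : #|[set u | D x u <= rho.+1]| <= _).
  by apply/subset_leq_card/subsetP => u; rewrite !inE cdist_sym => /eqP->.
apply: leq_trans (cdist_card _ _) _; first exact: ltnW rho_lt_reach.
rewrite leq_mul2l leq_expn2 ?orbT //; have := rho_lt_reach; lia.
Qed.

Lemma near_le (X : {set 'I_n}) : #|X| <= K ->
  2 * #|[set u | [exists x in X, D x u <= reach]]| <= 2 ^ len.
Proof.
move=> XK; apply: leq_trans l_large; rewrite leq_mul2l /=.
apply: leq_trans (_ : \sum_(x in X) #|[set u | D x u <= reach]| <= _).
  rewrite -sum1_card big_mkcond.
  have -> : \sum_(x in X) #|[set u | D x u <= reach]| =
      \sum_u #|[set x in X | D x u <= reach]|.
    rewrite (eq_bigr (fun x => \sum_(u in [set u | D x u <= reach]) 1)) => [|x _].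
      rewrite (exchange_big_dep predT) //=; apply: eq_bigr => u _.
      by rewrite -sum1_card; apply: eq_bigl => x; rewrite !inE.
    by rewrite sum1_card.
  apply: leq_sum => u _; rewrite inE; case: ifP => // /exists_inP[x xX le].
  by rewrite card_gt0; apply/set0Pn; exists x; rewrite inE xX.
apply: leq_trans (_ : \sum_(x in X) C0 * (reach + 2) ^ d <= _).
  apply: leq_sum => x _; apply: leq_trans (cdist_card _ (leqnn _)) _.
  by rewrite leq_mul2l leq_expn2 ?orbT //; lia.
rewrite sum_nat_const leq_mul2r; apply/orP; right; apply: leq_trans XK _.
by rewrite leq_pmull ?C'_gt0.
Qed.

Lemma eq_selected (D' : 'I_n -> 'I_n -> nat) rad1 rad2 kap1 kap2 j1 j2 b x :
  rad1 =1 rad2 -> kap1 =1 kap2 ->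
  selected D' rad1 kap1 j1 j2 b x = selected D' rad2 kap2 j1 j2 b x.
Proof.
move=> er ek; rewrite /selected ek; congr (_ && (_ || _)).
  by congr (_ * _ <= _); apply: eq_card => u; rewrite !inE ek.
apply: eq_existsb => u; rewrite er; congr (_ && _).
by apply: eq_forallb => v; rewrite er.
Qed.

(** The 1 covers level 0, where clusters are single vertices; at higher levels the last passed test
    bounds ball size times [rho]. *)
Definition cluster_bound := maxn 1 (C' * K %/ rho).

Lemma cluster_le c u : #|[set x | D u x < radius k l C' c u]| <= cluster_bound.
Proof.
rewrite leq_max; case e: level => [|j].
  apply/orP; left; rewrite -[leqRHS](cards1 u); apply/subset_leq_card/subsetP => x.
  (* A block of no coins is vacuously all ones, and [len] is positive, so every radius stops at its
     first block. *)
  rewrite !inE; have -> : radius k l C' c u = 1.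
    rewrite /radius /stops /scan e mul1n; case: len len_gt0 => //.
  rewrite ltnS leqn0 => /eqP D0; have := @cdist_walk G reach.+1 u x.
  by rewrite D0 => /(_ isT) /walkP[[|? ?] [//= _ -> _]].
apply/orP; right; have rho0 : 0 < rho by rewrite muln_gt0 r_gt0 len_gt0.
rewrite -e leq_divRL //.
have /(level_good len_gt0) : j < level by rewrite e.
rewrite -e => /andP[_ /forallP/(_ u)]; apply: leq_trans.
rewrite leq_mul2r; apply/orP; right; apply/subset_leq_card/subsetP => x.
rewrite !inE => lt; rewrite -ltnS (leq_trans lt) //.
by rewrite ltnS (leq_trans (find_size _ _)) // size_iota.
Qed.

Lemma treedepth_cover c :
  treedepth [set x | selected D (radius k l C' c) (kept k l C' c) reach r (4 * K) x]
    <= 4 * K %/ r + cluster_bound.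
Proof.
apply: (@treedepth_selected _ _ _ _ _ _ _ _ rho) => //.
- exact: cdistxx.
- exact: cdist_sym.
- by move=> *; apply: cdist_triangle.
- by move=> *; apply: cdist_adj.
- by move=> u; rewrite ltnS (leq_trans (find_size _ _)) // size_iota.
- exact: cluster_le.
- exact: r_gt0.
- exact: reach_ge.
Qed.

(** * Independent blocks and rows read off the coin sequence *)

Notation index := ('I_n * 'I_rho * 'I_level + 'I_n * 'I_len)%type.

Definition column (i : index) : nat :=
  match i with
  | inl (_, j, i) => j * level + i
  | inr (_, i) => rho * level + i
  end.
Definition row (i : index) : 'I_n :=
  match i with inl (u, _, _) => u | inr (u, _) => u end.
Definition coin_index i := row i * rowlen + column i.

Lemma column_lt i : column i < rowlen.
Proof.
case: i => [[[u j] i]|[u i]] /=; last by rewrite ltn_add2l.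
apply: leq_trans (leq_addr _ _); apply: leq_trans (_ : j.+1 * level <= _).
  by rewrite mulSnr ltn_add2l.
by rewrite leq_mul2r ltn_ord orbT.
Qed.

Lemma coin_index_lt i : coin_index i < ncoins.
Proof.
apply: leq_trans (_ : (row i).+1 * rowlen <= _).
  by rewrite mulSnr ltn_add2l column_lt.
by rewrite leq_mul2r ltn_ord orbT.
Qed.

Lemma divmod_inj a b i j m : i < m -> j < m ->
  a * m + i = b * m + j -> a = b /\ i = j.
Proof.
move=> im jm e; have m0 : 0 < m by apply: leq_ltn_trans im.
have ab : a = b.
  by rewrite -[a]addn0 -[b]addn0 -{1}(divn_small im) -(divn_small jm) -!divnMDl // e.
by split=> //; apply/eqP; rewrite -(eqn_add2l (a * m)) e ab.
Qed.

Lemma coin_index_inj : injective coin_index.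
Proof.
move=> i j /(divmod_inj (column_lt i) (column_lt j))[/val_inj].
case: i => [[[u a] i]|[u i]]; case: j => [[[v b] j]|[v j]] /= -> e.
- by have [/val_inj-> /val_inj->] := divmod_inj (ltn_ord i) (ltn_ord j) e.
- have : a * level + i < rho * level.
    apply: leq_trans (_ : a.+1 * level <= _); first by rewrite mulSnr ltn_add2l.
    by rewrite leq_mul2r ltn_ord orbT.
  by rewrite e ltnNge leq_addr.
- have : b * level + j < rho * level.
    apply: leq_trans (_ : b.+1 * level <= _); first by rewrite mulSnr ltn_add2l.
    by rewrite leq_mul2r ltn_ord orbT.
  by rewrite -e ltnNge leq_addr.
- by move/addnI/val_inj: e => ->.
Qed.

Notation outcome := ({ffun 'I_n * 'I_rho -> {ffun 'I_level -> bool}} *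
  {ffun 'I_n -> {ffun 'I_len -> bool}})%type.

Definition outcome_bit (y : outcome) (i : index) :=
  match i with
  | inl (u, j, i) => y.1 (u, j) i
  | inr (u, i) => y.2 u i
  end.

Lemma outcome_bit_inj y z : outcome_bit y =1 outcome_bit z -> y = z.
Proof.
case: y z => [f g] [f' g'] e; congr (_, _).
  apply/ffunP => -[u j]; apply/ffunP => i; exact: (e (inl (u, j, i))).
apply/ffunP => u; apply/ffunP => i; exact: (e (inr (u, i))).
Qed.

Definition outcome_of (c : nat -> bool) : outcome :=
  ([ffun uj => [ffun i => c (coin_index (inl (uj.1, uj.2, i)))]],
   [ffun u => [ffun i => c (coin_index (inr (u, i)))]]).

Lemma all_iota_ord (P : pred nat) m : all P (iota 0 m) = [forall i : 'I_m, P i].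
Proof.
apply/allP/forallP => [all i|all i]; first by apply: all; rewrite mem_iota add0n ltn_ord.
by rewrite mem_iota add0n => /= im; apply: (all (Ordinal im)).
Qed.

Lemma rad_outcome c : draw (outcome_of c).1 =1 radius k l C' c.
Proof.
move=> u; rewrite /draw /radius -val_enum_ord find_map; congr _.+1.
apply: eq_find => j; rewrite /= /stops /scan all_iota_ord ffunE.
apply/eqP/forallP => [/ffunP e i|all].
  by have := e i; rewrite !ffunE /coin_index /= addnA.
by apply/ffunP => i; rewrite !ffunE /coin_index /= addnA all.
Qed.

Lemma kap_outcome c : kap (outcome_of c).2 =1 kept k l C' c.
Proof.
move=> u; rewrite /kap /kept /scan all_iota_ord ffunE.
apply/eqP/forallP => [/ffunP e i|all].
  by have := e i; rewrite !ffunE /coin_index /= addnA.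
by apply/ffunP => i; rewrite !ffunE /coin_index /= addnA all.
Qed.

(** Transfers [card_success] from uniform outcomes to uniform coin sequences, as the coins in use
    sit at distinct positions. *)
Lemma card_cover s T (X : {set 'I_n}) : #|X| <= K -> s + 6 * ncoins <= T ->
  2 ^ T <= 4 * 2 ^ (len * (4 * K %/ r)) * #|[set w : T.-tuple bool |
    X \subset [set x | selected D (radius k l C' (coins G k l C' s w))
      (kept k l C' (coins G k l C' s w)) reach r (4 * K) x]]|.
Proof.
move=> XK sT; pose c (w : T.-tuple bool) := coins G k l C' s w.
have pos_lt i : s + 6 * coin_index i + 2 < T.
  by have := coin_index_lt i; lia.
pose pos i := Ordinal (pos_lt i).
have posI : injective pos.
  by move=> i j /(congr1 val) /= e; apply: coin_index_inj; lia.
pose P (y : outcome) := X \subset [set x | selected D (draw y.1) (kap y.2) reach r (4 * K) x].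
have K0 : 0 < K by apply: ltnW K_ge2.
have succ := card_success (@cdistxx G reach.+1) K0 XK far_le (near_le XK).
have bits w i : outcome_bit (outcome_of (c w)) i = tnth w (pos i).
  have -> : outcome_bit (outcome_of (c w)) i = c w (coin_index i).
    by case: i => [[[u j] i]|[u i]]; rewrite /= !ffunE.
  by rewrite /c /coins coin_index_lt (tnth_nth false).
have := card_tuple_coordinates P posI outcome_bit_inj bits.
rewrite card_prod.
have -> : #|[set w | P (outcome_of (c w))]| = #|[set w : T.-tuple bool |
    X \subset [set x | selected D (radius k l C' (coins G k l C' s w))
      (kept k l C' (coins G k l C' s w)) reach r (4 * K) x]]|.
  apply: eq_card => w; rewrite !inE /P.
  suff -> : [set x | selected D (draw (outcome_of (c w)).1) (kap (outcome_of (c w)).2)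
      reach r (4 * K) x] = [set x | selected D (radius k l C' (c w)) (kept k l C' (c w))
      reach r (4 * K) x] by [].
  apply/setP => x; by rewrite !inE (eq_selected _ _ _ _ _ (rad_outcome _) (kap_outcome _)).
move: succ; rewrite (_ : #|[set y | _]| = #|P|); last by apply: eq_card => y; rewrite inE.
set N := #|_| * #|_|; move: #|_| => W; move: #|P| => Q; set A := 4 * _ => succ e.
have N0 : 0 < N.
  rewrite /N muln_gt0; apply/andP; split; apply/card_gt0P.
    by exists [ffun=> [ffun=> true]].
  by exists [ffun=> [ffun=> true]].
rewrite -(leq_pmul2r N0) -mulnA e mulnA [_ * N]mulnC leq_mul2r succ orbT //.
Qed.

End Correctness.

(** * Constants and running time *)

Lemma exp_ge_linear a b : exists m, a + b * m <= 2 ^ m.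
Proof.
(* Doubling [t] makes the power at least (t + 1)^2, whose square term pays for [b * (2 * t)] and
   whose linear term pays for [a]. *)
exists (2 * (a + 2 * b)); set t := a + 2 * b.
have lt : t.+1 <= 2 ^ t by rewrite ltn_expl.
apply: leq_trans (_ : t.+1 * t.+1 <= _); last first.
  by rewrite mul2n -addnn expnD leq_mul.
have bt : b * (2 * t) <= t * t by rewrite mulnA leq_mul2r; apply/orP; right; rewrite /t; lia.
have at_ : a <= t by rewrite /t leq_addr.
by rewrite mulnSr mulSn; lia.
Qed.

Lemma exp_ge_poly c1 c2 d : exists e, c1 * (12 * (c2 + e)) ^ d <= 2 ^ e.
Proof.
have [m hm] := exp_ge_linear (c1 + (4 + c2) * d) d.
(* By 12 <= 2^4 and c2 + 2^m <= 2^(c2 + m) all factors become powers of two, with a total exponent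
   linear in [m]. *)
exists (2 ^ m); apply: leq_trans (_ : 2 ^ (c1 + (4 + c2) * d + d * m) <= _); last by rewrite leq_exp2l.
rewrite -addnA [d * m]mulnC -mulnDl expnD expnM; apply: leq_mul; first exact/ltnW/ltn_expl.
apply: leq_expn2; rewrite !expnD -mulnA; apply: leq_mul => //.
apply: leq_trans (_ : c2.+1 * 2 ^ m <= _); last by rewrite leq_mul2r ltn_expl // orbT.
by rewrite mulSn addnC leq_add2l leq_pmulr // expn_gt0.
Qed.

(** The horizon itself grows with [l]. With [P] the power of two above [K], the left side is at most
    [P ^ (1 + 2 * d)] times a polynomial in [l]; the latter is at most [2 ^ e], hence at most
    [P ^ e]. *)
Lemma exists_len_factor C0 d : exists2 l, 0 < l & forall (G : sgraph) k,
  let C' := C0 * 2 ^ d in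
  2 * (C' * kcap G k * (C0 * (horizon G k l C' + 2) ^ d)) <= 2 ^ bits G k l.
Proof.
set C' := C0 * 2 ^ d.
have [e he] := exp_ge_poly (2 * (C' * C0)) (C' + 2 * d + 2) d.
exists (1 + 2 * d + e) => // G k /=; set K := kcap G k.
have K2 : 1 < K by rewrite /K /kcap addn2.
set P := 2 ^ up_log 2 K; set l := 1 + 2 * d + e.
have KP : K <= P by rewrite up_logP.
have P2 : 2 <= P by apply: leq_trans K2 KP.
have lenP : bits G k l <= l * P.
  by rewrite /bits leq_mul2l ltnW ?orbT // ltn_expl.
have -> : 2 ^ bits G k l = P ^ l by rewrite /bits mulnC expnM.
set A := 12 * (C' + 2 * d + 2 + e) in he.
have AE : A = 12 * (C' + l + 1) by rewrite /A /l; lia.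
have reachA : horizon G k l C' + 2 <= P ^ 2 * A.
  rewrite /horizon -/K AE; set x := bits G k l in lenP *; clearbody x P K l.
  apply: leq_trans (_ : P * (5 * (2 * C' * P + (2 * (l * P) + 2))) + 2 <= _).
    rewrite leq_add2r leq_mul // leq_mul2l /= leq_add ?leq_mul2l ?KP ?orbT //.
    by rewrite leq_add2r leq_mul2l.
  rewrite expnS expn1; nia.
apply: leq_trans (_ : 2 * (C' * P * (C0 * (P ^ 2 * A) ^ d)) <= _).
  by rewrite leq_mul2l /= leq_mul // ?leq_mul2l ?KP ?leq_expn2 ?orbT.
rewrite expnMn -expnM /l [P ^ (_ + e)]expnD [P ^ (1 + _)]expnD expn1.
apply: leq_trans (_ : P * P ^ (2 * d) * (2 * (C' * C0) * A ^ d) <= _).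
  rewrite leq_eqVlt; apply/orP; left; apply/eqP; move: (A ^ d) (P ^ _) => x y; clear; lia.
rewrite leq_mul2l; apply/orP; right; apply: leq_trans he _; exact: leq_expn2.
Qed.

(** * Polynomial bound on the number of steps *)

Definition poly_bounded (f : nat -> nat) :=
  exists p : {poly nat}, forall x, f x <= p.[x]%R.

Lemma poly_bounded_const a : poly_bounded (fun=> a).
Proof. by exists a%:P%R => x; rewrite hornerC. Qed.

Lemma poly_bounded_id : poly_bounded id.
Proof. by exists 'X%R => x; rewrite hornerX. Qed.

Lemma poly_boundedD f g : poly_bounded f -> poly_bounded g ->
  poly_bounded (fun x => f x + g x).
Proof. by move=> [p fp] [q gq]; exists (p + q)%R => x; rewrite hornerD leq_add. Qed.

Lemma poly_boundedM f g : poly_bounded f -> poly_bounded g ->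
  poly_bounded (fun x => f x * g x).
Proof. by move=> [p fp] [q gq]; exists (p * q)%R => x; rewrite hornerM leq_mul. Qed.

Lemma poly_bounded_cost f c : poly_bounded f -> poly_bounded (fun x => cost (f x) c).
Proof.
move=> bf; have one := poly_bounded_const 1.
have succ g : poly_bounded g -> poly_bounded (fun x => (g x).+1).
  move=> bg; have [p hp] := poly_boundedD one bg; exists p; exact: hp.
elim: c => //= [c1 b1 c2 b2|_ c1 b1 c2 b2|_ c b].
- exact/succ/poly_boundedD.
- exact/succ/poly_boundedD.
- exact/succ/(poly_boundedM bf)/succ.
Qed.

(** Here [q] bounds [kcap] and [e] bounds [bits]; the summands dominate the iteration counts of the
    loops, the last one the number of coins. *)
Definition loop_bound l C' s :=
  let q := s + 2 in
  let e := l * q in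
  s + q + (q * (5 * (2 * C' * q + (2 * e + 2)))).+1 + (C' * q + e)
  + s * ((C' * q + e) * (C' * q) + e).

Lemma poly_bounded_loop_bound l C' : poly_bounded (loop_bound l C').
Proof.
have C a : poly_bounded (fun=> a) := poly_bounded_const a.
have q : poly_bounded (fun s => s + 2) := poly_boundedD poly_bounded_id (C 2).
have e := poly_boundedM (C l) q; have cq := poly_boundedM (C C') q.
have x := poly_boundedD cq e.
have y := poly_boundedD (poly_boundedM q (poly_boundedM (C 5)
  (poly_boundedD (poly_boundedM (C (2 * C')) q)
    (poly_boundedD (poly_boundedM (C 2) e) (C 2))))) (C 1).
have z := poly_boundedM poly_bounded_id (poly_boundedD (poly_boundedM x cq) e).
have [p hp] := poly_boundedD (poly_boundedD (poly_boundedD (poly_boundedD poly_bounded_id q) y) x) z.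
by exists p => s; apply: leq_trans (hp s); rewrite /loop_bound addn1.
Qed.

Lemma loop_boundP G k l C' s : 0 < C' -> 0 < l -> nv G <= s ->
  let B := loop_bound l C' s in
  [/\ nv G <= B, kcap G k <= B, up_log 2 (kcap G k) <= B, horizon G k l C' < B &
    [/\ C' * kcap G k + bits G k l <= B & ncoins G k l C' <= B]].
Proof.
move=> C0 l0 ns B; set K := kcap G k; set q := s + 2; set e := l * q.
have Kq : K <= q by rewrite /K /kcap /q; lia.
have K2 : 1 < K by rewrite /K /kcap addn2.
have lgK : up_log 2 K <= K by apply: up_log_min => //; apply/ltnW/ltn_expl.
have le : bits G k l <= e by rewrite /bits leq_mul2l (leq_trans lgK) ?orbT.
have CK : C' * K <= C' * q by rewrite leq_mul2l Kq orbT.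
have reachq : horizon G k l C' <= q * (5 * (2 * C' * q + (2 * e + 2))).
  rewrite /horizon -/K; apply: leq_mul => //; rewrite leq_mul2l; apply: leq_add.
    by rewrite leq_mul2l Kq orbT.
  by rewrite leq_add2r leq_mul2l le orbT.
have l1 : 0 < bits G k l by rewrite /bits muln_gt0 l0 up_log_gt0.
have nq : ncoins G k l C' <= s * ((C' * q + e) * (C' * q) + e).
  rewrite /ncoins leq_mul // leq_add // leq_mul //.
    by apply: leq_trans (rho_le _ l1) _; rewrite leq_add.
  exact: leq_trans (level_le _ l1) CK.
rewrite /B /loop_bound -/q -/e.
by split; last split; lia.
Qed.

Lemma cover_algorithm C0 d : 0 < C0 -> exists l (p : {poly nat}), 0 < l /\
  forall G k, (forall j, 0 < j -> forall v : 'I_(nv G), #|ball v j| <= C0 * j ^ d) ->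
  let C' := C0 * 2 ^ d in let alg := cover_cmd l C' in
  let K := kcap G k in let r := 2 ^ level G k l C' in
  let T := p.[input_size G k]%R in
  (forall w : T.-tuple bool, halted (run alg G k w) /\
     treedepth (output alg G k w) <= 4 * K %/ r + maxn 1 (C' * K %/ (r * bits G k l))) /\
  (forall X : {set 'I_(nv G)}, #|X| <= K ->
     2 ^ T <= 4 * 2 ^ (bits G k l * (4 * K %/ r)) *
       #|[set w : T.-tuple bool | X \subset output alg G k w]|).
Proof.
move=> C00; have [l l0 hl] := exists_len_factor C0 d.
set C' := C0 * 2 ^ d.
have [p hp] := poly_bounded_cost (cover_cmd l C') (poly_bounded_loop_bound l C').
exists l, p; split=> // G k grow; set B := loop_bound l C' (input_size G k).
have C'0 : 0 < C' by rewrite muln_gt0 C00 expn_gt0.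
have [nB KB lgB reachB [rhoB NB]] := loop_boundP k C'0 l0 (leq_addr _ _ : nv G <= input_size G k).
have l1 : 0 < bits G k l by rewrite /bits muln_gt0 l0 up_log_gt0 /kcap addn2.
have CB : C' * kcap G k <= B by apply: leq_trans rhoB; apply: leq_addr.
have [s [sT runP]] := run_cover nB KB lgB reachB l1 CB rhoB NB.
move=> C1 alg K r T; have costT : cost B alg <= T by exact: hp.
split=> [w|X XK].
  have [|-> ->] := runP w; first by rewrite size_tuple.
  by split=> //; apply: treedepth_cover => //; apply: hl.
have sT' : s + 6 * ncoins G k l C' <= T by apply: leq_trans costT; apply: ltnW.
have := card_cover C00 l0 grow (hl G k) XK sT'.
congr (_ <= _ * _); apply: eq_card => w; rewrite !inE.
by have [|_ ->] := runP w; first by rewrite size_tuple.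
Qed.

(** * Real estimates *)

Local Open Scope ring_scope.

Section RealEstimates.
Variable R : realType.
Implicit Types x y z delta : R.

Lemma ln2_gt0 : 0 < ln 2 :> R.
Proof. by rewrite ln_gt0 // ltr1n. Qed.

Lemma ler_log2 x y : 0 < x -> x <= y -> log2 x <= log2 y.
Proof.
move=> x0 xy; rewrite /log2 ler_pM2r ?invr_gt0 ?ln2_gt0 //.
by rewrite ler_ln // posrE // (lt_le_trans x0).
Qed.

Lemma log2_ge1 (k : nat) : (2 <= k)%N -> 1 <= log2 k%:R :> R.
Proof.
move=> k2; have e : log2 2 = 1 :> R by rewrite /log2 divff // gt_eqF // ln2_gt0.
by rewrite -[leLHS]e ler_log2 // ler_nat.
Qed.

Lemma up_log_le (k : nat) : (2 <= k)%N -> (up_log 2 k)%:R <= 2 * log2 k%:R :> R.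
Proof.
move=> k2; have lk := log2_ge1 k2.
suff h : (up_log 2 k).-1%:R <= log2 k%:R :> R.
  have -> : up_log 2 k = (up_log 2 k).-1.+1 by rewrite prednK // up_log_gt0.
  by rewrite -natr1; lra.
have lt := up_log_gtn (ltnSn 1) k2.
rewrite /log2 ler_pdivlMr ?ln2_gt0 // mulr_natl -lnXn // ler_ln ?posrE ?exprn_gt0 ?ltr0n //.
  by rewrite -natrX ler_nat ltnW.
exact: ltnW.
Qed.

(** A ball contains its center, whereas the growth bound drops below 1 for large radii. *)
Lemma growth_empty (cG : sgraph -> Prop) delta : polynomial_growth cG delta ->
  delta < 0 -> forall G, cG G -> nv G = 0%N.
Proof.
move=> [C hC] d0 G GG; apply/eqP; rewrite -leqn0 leqNgt; apply/negP => n0.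
pose v := Ordinal n0; have a0 : 0 < - delta by rewrite oppr_gt0.
pose j := (Num.bound ((`|C| + 1) `^ (- delta)^-1)).+1.
have j1 : 1 <= j%:R :> R by rewrite ler1n.
have big : `|C| + 1 < j%:R `^ (- delta).
  have C1 : 0 <= `|C| + 1 by rewrite addr_ge0.
  rewrite -[X in X < _](powRr1 C1) -[X in _ `^ X < _](mulVf (lt0r_neq0 a0)) powRrM.
  rewrite gt0_ltr_powR ?nnegrE ?powR_ge0 // (lt_trans (archi_boundP (powR_ge0 _ _))) //.
  by rewrite ltr_nat.
have := hC G GG j (ltn0Sn _) v; rewrite -[delta]opprK powRN => le.
have le1 : 1 <= #|ball v j|%:R :> R.
  rewrite ler1n card_gt0; apply/set0Pn; exists v; rewrite inE /dist.
  case: {-}_ / idP => [c|]; last by case; apply: connect0.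
  by case: ex_minnP => d _ min; rewrite ltnS (leq_trans (min 0 (walk0 v))).
have p0 : 0 < j%:R `^ (- delta) by apply: le_lt_trans big; rewrite addr_ge0.
have := le_trans le1 le; rewrite ler_pdivlMr // mul1r => le2.
have := ler_norm C; lra.
Qed.

(** The real exponent is retained for the final estimate of the scale; the integer degree serves the
    counting arguments. *)
Lemma growth_nat (cG : sgraph -> Prop) delta : polynomial_growth cG delta ->
  0 <= delta -> exists C0 d : nat, [/\ (0 < C0)%N, delta <= d%:R,
    forall G, cG G -> forall j, (0 < j)%N -> forall v : 'I_(nv G),
      #|ball v j|%:R <= C0%:R * j%:R `^ delta &
    forall G, cG G -> forall j, (0 < j)%N -> forall v : 'I_(nv G),
      (#|ball v j| <= C0 * j ^ d)%N].
Proof.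
move=> [C hC] d0; pose C0 := (Num.bound `|C|).+1; pose d := Num.bound delta.
have hR G : cG G -> forall j, (0 < j)%N -> forall v : 'I_(nv G),
    #|ball v j|%:R <= C0%:R * j%:R `^ delta.
  move=> GG j j0 v; apply: le_trans (hC G GG j j0 v) _.
  rewrite ler_wpM2r ?powR_ge0 //; apply: le_trans (ler_norm C) _.
  by rewrite ltW // (lt_trans (archi_boundP (normr_ge0 C))) // ltr_nat.
have dd : delta <= d%:R by rewrite ltW // archi_boundP.
exists C0, d; split=> // G GG j j0 v.
rewrite -(ler_nat R); apply: le_trans (hR G GG j j0 v) _.
by rewrite natrM natrX ler_wpM2l // -powR_mulrn // ler_powR // ler1n.
Qed.

(** The doubled radius [rho2] failed its test, so it exceeds [C' * K] or does so after
    multiplication by some ball size. Either way K <= rho2^(1 + delta); taking the root and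
    multiplying by the complementary power of [K] gives the bound. *)
Lemma level_large (G : sgraph) k l C0 d delta :
  0 <= delta -> delta <= d%:R -> (0 < bits G k l)%N ->
  (forall j, (0 < j)%N -> forall v : 'I_(nv G), #|ball v j|%:R <= C0%:R * j%:R `^ delta) ->
  (0 < C0)%N ->
  (kcap G k)%:R <= 2 * (2 ^ level G k l (C0 * 2 ^ d))%N%:R * (bits G k l)%:R
    * (kcap G k)%:R `^ (1 - 1 / (1 + delta)) :> R.
Proof.
move=> d0 dd len0 grow C00; set K := kcap G k; set C' := (C0 * 2 ^ d)%N.
set rho2 := (2 ^ (level G k l C').+1 * bits G k l)%N.
have K2 : (2 <= K)%N by rewrite /K /kcap addn2.
have C'0 : (0 < C')%N by rewrite muln_gt0 C00 expn_gt0.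
have rho1 : (1 <= rho2)%N by rewrite muln_gt0 expn_gt0 len0.
have rhoR : 1 <= rho2%:R :> R by rewrite ler1n.
have dp : 0 < 1 + delta by rewrite ltr_wpDr.
have main : K%:R <= rho2%:R `^ (1 + delta) :> R.
  have [le|lt] := leqP rho2 (C' * K); last first.
    apply: le_trans (_ : rho2%:R <= _); last by rewrite le1r_powR // lerDl.
    by rewrite ler_nat (leq_trans _ (ltnW lt)) // leq_pmull.
  have := level_bad C' len0; rewrite /good -/rho2 le => /forallPn[u]; rewrite -ltnNge => lt.
  have reachK : (rho2 < (horizon G k l C').+1)%N.
    by rewrite ltnS (leq_trans le) // /horizon -/K; nia.
  have ballR : (C' * K)%:R <= C0%:R * (rho2.+1)%:R `^ delta * rho2%:R :> R.
    apply: le_trans (_ : (#|ball u rho2.+1| * rho2)%:R <= _).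
      rewrite ler_nat (leq_trans (ltnW lt)) // leq_mul2r; apply/orP; right.
      exact/subset_leq_card/cdist_ball.
    by rewrite natrM ler_wpM2r // grow.
  (* The factor [2 ^ d] in [C'] absorbs the passage from [rho2] to [rho2.+1 <= 2 * rho2]. *)
  have p2 : (rho2.+1)%:R `^ delta <= (2 ^ d)%:R * rho2%:R `^ delta :> R.
    apply: le_trans (_ : (2 * rho2%:R) `^ delta <= _).
      rewrite ge0_ler_powR ?nnegrE ?mulr_ge0 // -natr1; lra.
    rewrite powRM // ler_wpM2r ?powR_ge0 // natrX -powR_mulrn // ler_powR //.
    by rewrite ler1n.
  have C0R : 0 < C0%:R :> R by rewrite ltr0n.
  have C'R : 0 < C'%:R :> R by rewrite ltr0n.
  rewrite -(ler_pM2l C'R) -natrM; apply: le_trans ballR _.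
  rewrite powRD; last by apply/implyP => _; rewrite gt_eqF // ltr0n.
  rewrite powRr1 // [leRHS](_ : _ = C0%:R * ((2 ^ d)%:R * rho2%:R `^ delta) * rho2%:R).
    by rewrite ler_wpM2r // ler_pM2l.
  by rewrite /C' natrM; ring.
have K0 : 0 < K%:R :> R by rewrite ltr0n ltnW.
have root : K%:R `^ (1 / (1 + delta)) <= rho2%:R :> R.
  apply: le_trans (_ : (rho2%:R `^ (1 + delta)) `^ (1 / (1 + delta)) <= _).
    by rewrite ge0_ler_powR ?nnegrE ?powR_ge0 ?divr_ge0 // ltW.
  by rewrite -powRrM div1r divff ?powRr1 // gt_eqF.
have -> : 2 * (2 ^ level G k l C')%N%:R * (bits G k l)%:R = rho2%:R :> R.
  by rewrite /rho2 expnS !natrM.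
have KE : K%:R = K%:R `^ (1 / (1 + delta)) * K%:R `^ (1 - 1 / (1 + delta)) :> R.
  by rewrite -powRD ?subrKC ?powRr1 ?ltW //; apply/implyP => _; rewrite gt_eqF.
by rewrite [leLHS]KE ler_wpM2r ?powR_ge0.
Qed.

End RealEstimates.

Theorem theorem1 (R : realType) (cG : sgraph -> Prop) (delta : R)
    (hG : polynomial_growth cG delta) :
  exists (c : R) (alg : cmd) (p : {poly nat}), 0 < c /\
    forall (G : sgraph) (k : nat), cG G ->
      let T := p.[input_size G k] in
      (forall w : T.-tuple bool, halted (run alg G k w)) /\
      ((2 <= k)%N ->
        (forall w : T.-tuple bool,
          (treedepth (output alg G k w))%:R
            <= c * k%:R `^ (1 - 1 / (1 + delta)) * log2 k%:R) /\
        (forall X : {set 'I_(nv G)}, (#|X| <= k)%N ->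
          2 `^ (- (c * k%:R `^ (1 - 1 / (1 + delta)) * log2 k%:R ^+ 2))
            <= Pr_output R alg k T (fun A : {set 'I_(nv G)} => X \subset A))).
Proof.
have [neg|delta0] := ltP delta 0.
  (* A negative degree leaves only empty graphs, for which [Skip] with its single step suffices. *)
  exists 1, Skip, 1%:P; split=> // G k GG T; have G0 := growth_empty hG neg GG.
  have T1 : T = 1%N by rewrite /T hornerC.
  have noV (x : 'I_(nv G)) : False by case: x => i; rewrite G0.
  have all0 (A B : {set 'I_(nv G)}) : A = B by apply/setP => x; case: (noV x).
  clearbody T; rewrite {T}T1.
  split=> [w|k2]; first by rewrite /run; case: w => -[|b []].
  have lk := log2_ge1 R k2.
  split=> [w|X _].
    rewrite (all0 (output _ _ _ _) set0) treedepth0 mul1r mulr_ge0 ?powR_ge0 //.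
    exact: le_trans lk.
  rewrite /Pr_output (_ : [set w | _] = setT); last first.
    by apply/setP => w; rewrite !inE; apply/subsetP => x; case: (noV x).
  rewrite cardsT card_tuple card_bool [leRHS]divff ?pnatr_eq0 // powRN invf_le1 ?powR_gt0 //.
  rewrite -[leLHS](powRr0 2) ler_powR ?ler1n // mul1r mulr_ge0 ?powR_ge0 ?sqr_ge0 //.
have [C0 [d [C00 dd growR growN]]] := growth_nat hG delta0.
have [l [p [l0 algP]]] := cover_algorithm d C00.
set C' := (C0 * 2 ^ d)%N in algP; set alg := cover_cmd l C'.
(* The term 32 l^2 pays for the exponent of the probability, 16 l for the kept vertices and 2 C' for
   the clusters; the 3 covers the bound 1 on small clusters and the factor 4 = 2^2. *)
exists (32 * l%:R ^+ 2 + 16 * l%:R + 2 * C'%:R + 3), alg, p.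
have lR : 1 <= l%:R :> R by rewrite ler1n.
have CR : 0 <= C'%:R :> R by [].
set c := _ + 3; have c0 : 0 < c by rewrite /c; nra.
split=> // G k GG T.
have [haltP coverP] := algP G k (growN G GG); split=> [w|k2]; first by case: (haltP w).
set K := kcap G k in haltP coverP; set r := (2 ^ _)%N in haltP coverP.
set e := bits G k l in haltP coverP; set beta := 1 - 1 / (1 + delta).
have K2 : (2 <= K)%N by rewrite /K /kcap addn2.
have Kk : (K <= k)%N by rewrite /K /kcap; lia.
have e0 : (0 < e)%N by rewrite muln_gt0 l0 up_log_gt0.
have beta0 : 0 <= beta.
  by rewrite subr_ge0 div1r invf_le1 ?lerDl // ltr_wpDr.
have r0 : 0 < r%:R :> R by rewrite ltr0n expn_gt0.
have eR : 0 < e%:R :> R by rewrite ltr0n.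
have lK1 := log2_ge1 R K2; set lK := log2 K%:R in lK1.
have lKk : lK <= log2 k%:R by rewrite ler_log2 ?ltr0n ?ler_nat // ltnW.
have pKk : K%:R `^ beta <= k%:R `^ beta by rewrite ge0_ler_powR ?nnegrE ?ler_nat.
set x := K%:R `^ beta in pKk.
have x1 : 1 <= x.
  by rewrite -(powRr0 K%:R) ler_powR // ler1n ltnW.
have e_le : e%:R <= 2 * l%:R * lK.
  by rewrite /e /bits natrM -mulrA mulrCA ler_wpM2l // up_log_le.
have Kx := level_large delta0 dd e0 (growR G GG) C00 : K%:R <= 2 * r%:R * e%:R * x.
have quot : (4 * K %/ r)%:R <= 8 * e%:R * x.
  rewrite -(ler_pM2r r0); apply: le_trans (_ : (4 * K)%:R <= _).
    by rewrite -natrM ler_nat leq_divM.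
  rewrite natrM (_ : 8 * e%:R * x * r%:R = 4 * (2 * r%:R * e%:R * x)); last by ring.
  by rewrite ler_wpM2l.
have quot2 : (C' * K %/ (r * e))%:R <= 2 * C'%:R * x.
  have re0 : 0 < (r * e)%:R :> R by rewrite natrM mulr_gt0.
  rewrite -(ler_pM2r re0); apply: le_trans (_ : (C' * K)%:R <= _).
    by rewrite -natrM ler_nat leq_divM.
  rewrite [(C' * K)%:R]natrM [(r * e)%:R]natrM (_ : 2 * C'%:R * x * (r%:R * e%:R) = C'%:R * (2 * r%:R * e%:R * x)); last by ring.
  by rewrite ler_wpM2l.
split=> [w|X Xk].
  have [_ td] := haltP w.
  (* The estimates are made in the capped parameter [K] and passed on to [k] by monotonicity. *)
  apply: le_trans (_ : c * x * lK <= _); last first.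
    rewrite -!mulrA ler_pM2l // ler_pM //; lra.
  apply: le_trans (_ : (4 * K %/ r)%:R + (1 + (C' * K %/ (r * e))%:R) <= _).
    rewrite -[1]/(1%:R) -!natrD ler_nat (leq_trans td) // leq_add2l.
    by rewrite geq_max leq_addr leq_addl.
  have xl : 1 <= x * lK by rewrite -[1]mulr1 ler_pM.
  have xl' : x <= x * lK by rewrite ler_peMr // (le_trans ler01).
  have ex : e%:R * x <= 2 * l%:R * (x * lK).
    rewrite (_ : 2 * l%:R * (x * lK) = 2 * l%:R * lK * x); last by ring.
    by rewrite ler_wpM2r // (le_trans ler01).
  have Cx : C'%:R * x <= C'%:R * (x * lK) by rewrite ler_wpM2l.
  have l2 : 0 <= l%:R ^+ 2 * (x * lK) by rewrite mulr_ge0 ?sqr_ge0 // (le_trans ler01).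
  rewrite -mulrA /c; move: quot quot2; rewrite -!mulrA; lra.
(* Capping [k] excludes no set, since [X] has at most [nv G] vertices. *)
have XK : (#|X| <= K)%N.
  have Xn : (#|X| <= nv G)%N by rewrite -[leqRHS]card_ord max_card.
  rewrite /K /kcap; clear -k2 Xk Xn; lia.
have {}coverP := coverP X XK.
set q := (4 * K %/ r)%N in coverP quot.
apply: le_trans (_ : 2 `^ (- (2 + e * q)%:R) <= _).
  rewrite ler_powR ?ler1n // lerN2 natrD natrM.
  have eq_le : e%:R * q%:R <= 32 * l%:R ^+ 2 * (x * lK ^+ 2).
    have h1 : e%:R * q%:R <= e%:R * (8 * e%:R * x) by rewrite ler_wpM2l.
    apply: le_trans h1 _.
    have h2 : e%:R ^+ 2 <= (2 * l%:R * lK) ^+ 2.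
      by rewrite ler_pXn2r ?nnegrE // ltW // (lt_le_trans eR).
    have h3 := ler_wpM2r (le_trans ler01 x1) h2.
    rewrite (_ : e%:R * (8 * e%:R * x) = 8 * (e%:R ^+ 2 * x)); last by ring.
    rewrite (_ : 32 * l%:R ^+ 2 * (x * lK ^+ 2) = 8 * ((2 * l%:R * lK) ^+ 2 * x)); last by ring.
    by rewrite ler_wpM2l.
  have xl : 1 <= x * lK ^+ 2.
    by rewrite -[1]mulr1 ler_pM // exprn_ege1.
  apply: le_trans (_ : c * (x * lK ^+ 2) <= _); last first.
    rewrite -!mulrA ler_pM2l // ler_pM ?sqr_ge0 ?(le_trans ler01) //.
    by rewrite ler_pXn2r ?nnegrE ?(le_trans ler01) // (le_trans lK1).
  have l2 : 0 <= l%:R * (x * lK ^+ 2) by rewrite mulr_ge0 // (le_trans ler01).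
  have l3 : 0 <= C'%:R * (x * lK ^+ 2) by rewrite mulr_ge0 // (le_trans ler01).
  rewrite /c; lra.
rewrite powRN powR_mulrn // /Pr_output ler_pdivlMr ?exprn_gt0 // mulrC ler_pdivrMr ?exprn_gt0 //.
rewrite -!natrX -natrM ler_nat mulnC expnD; exact: coverP.
Qed.
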